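(* Let $k\ge1$ and $n\ge 2k+1$. There is a bijection between the $k$-triangulations of a convex $n$-gon (vertices labeled $1,\dots,n$ counterclockwise) with degree sequence $(d_1,\dots,d_{n-k-1})$ and the $k$-tuples $\mathbf P\in\mathcal D_n^k$ with parameters $(h_0,h_1,\dots,h_k)$ and $(u_1,\dots,u_{n-2k-2})$, where $$d_i=\begin{cases}h_{i-1}&\text{if }1\le i\le k+1,\\ n-i-k-u_{i-k-1}&\text{if }k+1<i\le n-k-1.\end{cases}$$
   Context: A $k$-triangulation of a convex $n$-gon is a maximal set of diagonals such that no $k+1$ of them mutually cross. Diagonals between vertices at distance at most $k$ (distance = number of polygon sides separating them) are trivial; the neighbors of a vertex are the vertices joined to it by a nontrivial diagonal. For a $k$-triangulation, $d_i$ is the number of neighbors of vertex $i$ among $i+1,\dots,n$, and $(d_1,\dots,d_{n-k-1})$ is its degree sequence. Let $m=n-2k-1$, $T=N^mE^m$, $B=(EN)^m$ (steps $N=(0,1)$, $E=(1,0)$). $\mathcal D_n^k$ is the set of $k$-tuples $(P_1,\dots,P_k)$ of $N/E$ lattice paths from the origin to $(m,m)$, each weakly above $B$ and weakly below $T$, with $P_i$ weakly above $P_{i+1}$. With $P_0=T$, $P_{k+1}=B$, $h_i$ is the number of east steps on which $P_i$ and $P_{i+1}$ coincide ($0\le i\le k$), and $u_s$ ($1\le s\le m-1$) is the number of unit east steps at $y$-coordinate $m-s$ lying strictly between $T$ and $B$ and not used by any $P_i$. *)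

(* Defs.v *)
From mathcomp Require Import all_boot all_order all_algebra.

Set Implicit Arguments.
Unset Strict Implicit.
Unset Printing Implicit Defensive.

(* The vertices of the convex n-gon are the elements v of 'I_n, in their       *)
(* cyclic order; v carries the label v + 1, so that labels range over 1..n.    *)
Definition label n (v : 'I_n) : nat := v.+1.

Definition polygon_dist n (a b : 'I_n) : nat :=
  let l := ((a - b) + (b - a))%N in minn l (n - l).

(* A diagonal is stored as the pair of its endpoints, smaller label first;     *)
(* the sides of the polygon (distance 1) are not diagonals.                    *)
Definition is_diagonal n (p : 'I_n * 'I_n) : bool :=
  (p.1 < p.2)%N && (1 < polygon_dist p.1 p.2)%N.

(* In a convex polygon, two diagonals meet in their interiors iff their        *)
(* endpoints strictly alternate.                                               *)
Definition crossing n (p q : 'I_n * 'I_n) : bool :=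
  [&& p.1 < q.1, q.1 < p.2 & p.2 < q.2]%N
  || [&& q.1 < p.1, p.1 < q.2 & q.2 < p.2]%N.

Definition mutually_crossing n (X : {set 'I_n * 'I_n}) : bool :=
  [forall p in X, forall q in X, (p != q) ==> crossing p q].

Definition no_big_crossing n (k : nat) (S : {set 'I_n * 'I_n}) : bool :=
  [forall p in S, is_diagonal p]
  && [forall X : {set 'I_n * 'I_n},
        (X \subset S) && (#|X| == k.+1) ==> ~~ mutually_crossing X].

Definition ktriangulation n (k : nat) (S : {set 'I_n * 'I_n}) : bool :=
  maxset (no_big_crossing k) S.

Definition neighbor n (k : nat) (S : {set 'I_n * 'I_n}) (v w : 'I_n) : bool :=
  (((v, w) \in S) || ((w, v) \in S)) && (k < polygon_dist v w)%N.

Definition degree n (k : nat) (S : {set 'I_n * 'I_n}) (v : 'I_n) : nat :=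
  #|[set w : 'I_n | (label v < label w)%N & neighbor k S v w]|.

(* Lattice paths start at the origin and are given by their words of steps.    *)
Definition step := bool.
Definition stepN : step := true.
Definition stepE : step := false.

Definition is_path (m : nat) (w : seq step) : bool :=
  (count_mem stepN w == m) && (count_mem stepE w == m).

Definition topT (m : nat) : seq step := nseq m stepN ++ nseq m stepE.
Definition botB (m : nat) : seq step := flatten (nseq m [:: stepE; stepN]).

(* The y-coordinates of the successive east steps of w, started at height y.   *)
Fixpoint east_heights (y : nat) (w : seq step) : seq nat :=
  if w is s :: w' then
    if s == stepN then east_heights y.+1 w' else y :: east_heights y w'
  else [::].

(* The y-coordinate of the east step of w from abscissa x to abscissa x + 1.   *)
Definition east_height (w : seq step) (x : nat) : nat :=
  nth 0%N (east_heights 0 w) x.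

Definition weakly_above (m : nat) (P Q : seq step) : bool :=
  [forall x : 'I_m, east_height Q x <= east_height P x]%N.

(* The tuple (P_1, ..., P_k) of the mathematics is stored with indices from 0. *)
Definition in_D (m k : nat) (P : k.-tuple (seq step)) : bool :=
  all (fun w => [&& is_path m w, weakly_above m w (botB m)
                  & weakly_above m (topT m) w]) P
  && sorted (weakly_above m) P.

(* P_i for 0 <= i <= k + 1, with P_0 = T and P_{k+1} = B.                      *)
Definition path_at (m k : nat) (P : k.-tuple (seq step)) (i : nat) : seq step :=
  nth [::] (topT m :: rcons P (botB m)) i.

Definition param_h (m k : nat) (P : k.-tuple (seq step)) (i : nat) : nat :=
  #|[set x : 'I_m | east_height (path_at m P i) x
                    == east_height (path_at m P i.+1) x]|.

(* The unit east step from (x, y) to (x + 1, y), with y = m - s, is strictly   *)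
(* between T and B when it is strictly below the east step of T and strictly   *)
(* above the east step of B over the same abscissas; its left end may lie on   *)
(* the initial vertical run of T.                                              *)
Definition param_u (m k : nat) (P : k.-tuple (seq step)) (s : nat) : nat :=
  #|[set x : 'I_m | (east_height (botB m) x < m - s < east_height (topT m) x)%N
                    & all (fun w => east_height w x != m - s)%N P]|.

(* Main.v *)
Require Import Defs.
From mathcomp Require Import all_boot all_order all_algebra.
From mathcomp Require Import perm zify ring.
From Stdlib Require Import FunctionalExtensionality.

(* Weight a k-triangulation by the product of t_i over its nontrivial         *)
(* diagonals with smaller label i, and a tuple of paths by the product of the *)
(* variables t_i carried by its east steps: t_(i+1) for a contact of P_i with *)
(* P_(i+1), and t_(k+1+s) for an otherwise used step at height m - s. The     *)
(* theorem says that both generating functions agree; comparing coefficients  *)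
(* then yields the bijection.                                                 *)
(*                                                                            *)
(* Triangulations: reading the complement of S row by row as a network of     *)
(* adjacent comparators, the 0-1 principle and the recursion for longest      *)
(* chains show that S has no (k+1)-crossing iff the network sorts the         *)
(* decreasing sequence. So S is maximal iff every comparator acts, and the    *)
(* generating function is a coefficient of a product of row operators         *)
(* A_r(t) = (t + u_m) ... (t + u_r) in the nilCoxeter algebra. By the         *)
(* Yang--Baxter equation A_r(x) A_r(y) is symmetric, whence, for Z free of x  *)
(* and y,                                                                     *)
(*   (y - x) A_r(x) A_r(y) Z                                                  *)
(*     = y^2 A_r(x) A_(r+1)(y) Z - x^2 A_r(y) A_(r+1)(x) Z.                   *)
(*                                                                            *)
(* Paths: let the last column be released path by path. For one path between  *)
(* fixed neighbours, the sums obtained by exchanging the variables of its     *)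
(* upper and lower contacts are linked column by column; this gives the same  *)
(* recursion, with x and y the two contact variables, and also the symmetry   *)
(* by which the labels are permuted when a new column is added.               *)

Set Implicit Arguments.
Unset Strict Implicit.
Unset Printing Implicit Defensive.

Import Order.TTheory GRing.Theory Num.Theory.
Local Open Scope ring_scope.

(** * Row operators in the nilCoxeter algebra *)

(** Both families consist of objects carrying a multiset of labels. A nontrivial diagonal carries
    its smaller endpoint, so d_i is the multiplicity of i ([degree_network_of]); a tuple of paths
    carries i h_(i-1) times for i <= k+1, and k+1+s exactly m-s-u_s times ([count_param_h],
    [count_param_u]). The bijection is not explicit: it suffices that every multiset is carried
    equally often on both sides ([bij_of_perm]).

    This equidistribution is [network_gf_fan_gf]. Each side is embedded in a family G_0, ..., G_k
    ([released_network_gf], [released_fan_gf]), where G_k is the wanted function, G_0 is the one for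
    m-1 with all variables shifted by one, and (t_(s+2) - t_(s+1)) G_(s+1)(t) = t_(s+2)^2 G_s(t) -
    t_(s+1)^2 G_s(t'), with t' exchanging t_(s+1) and t_(s+2). For distinct nonzero variables in an
    integral domain the left factor cancels, and induction on m and s concludes. The recursion comes
    from [row_op_double] for networks and from [path_factor_exchange], that is from
    [path_sum_exchange], for paths.

    On the other side, [no_big_crossingP] says that a set of diagonals has no (k+1)-crossing iff the
    comparators at its missing cells sort the reversed word. All sorting networks make equally many
    swaps ([inv_run]), so maximality means that no comparator is idle ([ktriangulation_reduced],
    [reduced_ktriangulation]); these are the terms of the expanded operator product
    ([cells_op_subs]). Putting t_i = X^(B^i) for a large B, the exponents determine the
    multiplicities ([perm_of_poly], [digits]). *)

Definition swap (T : Type) (j : nat) (w : nat -> T) : nat -> T :=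
  fun x => if x == j then w j.+1 else if x == j.+1 then w j else w x.

Section Operators.
Variable R : idomainType.
Implicit Types (f g : (nat -> nat) -> R) (w : nat -> nat) (t : nat -> R).

(** The generator u_j of the nilCoxeter algebra, acting on functions of words: only a swap that
    removes an inversion survives, whence u_j^2 = 0. *)
Definition nil_op j f : (nat -> nat) -> R :=
  fun w => if (w j.+1 < w j)%N then f (swap j w) else 0.

Definition cell_op (a : R) j f : (nat -> nat) -> R :=
  fun w => a * f w + nil_op j f w.

Definition lin a f b g : (nat -> nat) -> R := fun w => a * f w + b * g w.

Lemma swapjj (T : Type) j (w : nat -> T) : swap j w j = w j.+1.
Proof. by rewrite /swap eqxx. Qed.

Lemma swapjS (T : Type) j (w : nat -> T) : swap j w j.+1 = w j.
Proof. by rewrite /swap eqxx; case: eqP => // /eqP; rewrite eqn_leq ltnn. Qed.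

Lemma swap_out (T : Type) j x (w : nat -> T) : x != j -> x != j.+1 ->
  swap j w x = w x.
Proof. by rewrite /swap => /negbTE -> /negbTE ->. Qed.

Lemma nil_op_lin j a f b g : nil_op j (lin a f b g) =
  lin a (nil_op j f) b (nil_op j g).
Proof.
apply: functional_extensionality => w; rewrite /nil_op /lin.
by case: ifP => // _; rewrite !mulr0 addr0.
Qed.

Lemma nil_op_sq j f w : nil_op j (nil_op j f) w = 0.
Proof.
by rewrite /nil_op swapjj swapjS; case: ifP => // h; case: ifP => // h'; lia.
Qed.

Lemma swap_swap_far i j w : (i.+1 < j)%N ->
  swap i (swap j w) = swap j (swap i w).
Proof.
move=> lij; apply: functional_extensionality => x; rewrite /swap.
by do !case: eqP => //; lia.
Qed.

Lemma nil_op_far i j f : (i.+1 < j)%N ->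
  nil_op i (nil_op j f) = nil_op j (nil_op i f).
Proof.
move=> lij; apply: functional_extensionality => w; rewrite /nil_op.
rewrite (@swap_swap_far i j) //.
rewrite !(@swap_out _ i j) ?(@swap_out _ i j.+1) ?(@swap_out _ j i) ?(@swap_out
  _ j i.+1); try lia.
do !case: ifP => //.
Qed.

Lemma swap_braid j w :
  swap j (swap j.+1 (swap j w)) = swap j.+1 (swap j (swap j.+1 w)).
Proof.
apply: functional_extensionality => x; rewrite /swap.
by do !case: eqP => //; lia.
Qed.

Lemma nil_op_braid j f : nil_op j (nil_op j.+1 (nil_op j f)) =
  nil_op j.+1 (nil_op j (nil_op j.+1 f)).
Proof.
apply: functional_extensionality => w; rewrite /nil_op swap_braid.
rewrite !(swapjj, swapjS) !(@swap_out _ j j.+2) ?(@swap_out _ j.+1 j); try lia.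
rewrite !(swapjj, swapjS) ?(@swap_out _ j j.+2) ?(@swap_out _ j.+1 j); try lia.
by do !case: ifP => //; lia.
Qed.

Lemma cell_op_lin a j b f c g : cell_op a j (lin b f c g) =
  lin b (cell_op a j f) c (cell_op a j g).
Proof.
apply: functional_extensionality => w; rewrite /cell_op nil_op_lin /lin; ring.
Qed.

Lemma cell_opE a j f : cell_op a j f = lin a f 1 (nil_op j f).
Proof. by apply: functional_extensionality => w;
  rewrite /cell_op /lin mul1r. Qed.

(* [row_op r n] is the product (a + u_{r+n-1}) ... (a + u_r). *)
Fixpoint row_op (a : R) r n f : (nat -> nat) -> R :=
  if n is n'.+1 then row_op a r.+1 n' (cell_op a r f) else f.

Lemma row_op_lin a r n b f c g :
  row_op a r n (lin b f c g) = lin b (row_op a r n f) c (row_op a r n g).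
Proof. by elim: n r f g => //= n IH r f g; rewrite cell_op_lin IH. Qed.

Lemma row_opS_top a r n f : row_op a r n.+1 f =
  cell_op a (r + n) (row_op a r n f).
Proof.
elim: n r f => [|n IH] r f; first by rewrite addn0.
rewrite [LHS]/= -[row_op a r.+2 n _]/(row_op a r.+1 n.+1 (cell_op a r f)) IH.
by rewrite addSnnS.
Qed.

Lemma nil_row_op_far j a r n f : (j.+1 < r)%N ->
  nil_op j (row_op a r n f) = row_op a r n (nil_op j f).
Proof.
elim: n r f => //= n IH r f lj; rewrite IH; last by lia.
by rewrite !cell_opE nil_op_lin nil_op_far.
Qed.

Lemma cell_row_op_far b j a r n f : (j.+1 < r)%N ->
  cell_op b j (row_op a r n f) = row_op a r n (cell_op b j f).
Proof. by move=> lj; rewrite !cell_opE nil_row_op_far // row_op_lin. Qed.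

(* The local form of the Yang--Baxter equation in the nilCoxeter algebra: the *)
(* left factor [y - u'] cancels [y + u'] up to the scalar [y ^ 2].            *)
Lemma yang_baxter_local (x y : R) j f :
  lin y (cell_op x j (cell_op y j.+1 (cell_op y j f))) (-1)
      (nil_op j.+1 (cell_op x j (cell_op y j.+1 (cell_op y j f)))) =
  lin (y ^+ 2) (lin 1 (lin (x * y) f (x + y) (nil_op j f)) 1
     (lin 1 (nil_op j (nil_op j.+1 f)) (-1) (nil_op j.+1 (nil_op j f)))) 0 f.
Proof.
have u0 i : nil_op i (fun _ => 0) = fun _ => 0.
  by apply: functional_extensionality => w; rewrite /nil_op; case: ifP.
have sq i g : nil_op i (nil_op i g) = fun _ => 0.
  by apply: functional_extensionality => w; rewrite nil_op_sq.
rewrite !cell_opE !nil_op_lin !sq !u0.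
rewrite nil_op_braid !sq.
apply: functional_extensionality => w; rewrite /lin; ring.
Qed.

(** Induction on the row length: the local Yang--Baxter identity reduces two rows to two shorter
    rows applied to an expression symmetric in the two variables. *)
Lemma row_op_comm (x y : R) r n f : x != 0 -> y != 0 ->
  row_op x r n (row_op y r n f) = row_op y r n (row_op x r n f).
Proof.
move=> x0 y0; elim: n r f => // -[|n] IH r f.
  rewrite /= !cell_opE !nil_op_lin; apply: functional_extensionality => w.
  by rewrite /lin nil_op_sq; ring.
(* [K] is what remains once (a + u_r)(b + u_(r+1))(b + u_r) has been moved inside; a further factor
   b + u_(r+1) completes it to two shorter rows, which commute by induction. *)
pose K (a b : R) g := row_op a r.+1 n.+1 (row_op b r.+2 n g).
have KE (a b : R) g :
    K a b (cell_op b r.+1 g) = row_op a r.+1 n.+1 (row_op b r.+1 n.+1 g) by [].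
have Ksym g : K x y (cell_op y r.+1 g) =
  K y x (cell_op x r.+1 g) by rewrite !KE IH.
have Klin (a b c : R) g d h : K a b (lin c g d h) = lin c (K a b g) d (K a b h).
  by rewrite /K !row_op_lin.
have AE (a b : R) : row_op a r n.+2 (row_op b r n.+2 f) =
    K a b (cell_op a r (cell_op b r.+1 (cell_op b r f))).
  by rewrite /K -(@cell_row_op_far a r b r.+2 n).
have sq : forall (c : R) g,
    cell_op c r.+1 (lin c g (-1) (nil_op r.+1 g)) = lin (c ^+ 2) g 0 g.
  move=> c g.
  apply: functional_extensionality => w.
  by rewrite cell_opE nil_op_lin /lin nil_op_sq; ring.
pose Z (a b : R) := lin 1 (lin (a * b) f (a + b) (nil_op r f)) 1
     (lin 1 (nil_op r (nil_op r.+1 f)) (-1) (nil_op r.+1 (nil_op r f))).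
(* Since (b + u)(b - u) = b^2, multiplying the local identity by b + u_(r+1) removes the factor b -
   u_(r+1); the scalar b^2 is then cancelled, which needs b nonzero. *)
have key (a b : R) : b != 0 ->
    K a b (cell_op a r (cell_op b r.+1 (cell_op b r f))) =
      K a b (cell_op b r.+1 (Z a b)).
  move=> b0; have := sq b (cell_op a r (cell_op b r.+1 (cell_op b r f))).
  rewrite yang_baxter_local -/(Z a b) => /(congr1 (K a b)).
  rewrite cell_op_lin !Klin => e; apply: functional_extensionality => w.
  move: (congr1 (fun F => F w) e); rewrite /lin !mul0r !addr0.
  by move/(mulfI (expf_neq0 2 b0)).
by rewrite !AE !key // Ksym /Z (mulrC x) (addrC x).
Qed.

(** Splitting y + u_r off the second row leaves y times a shorter row plus [Q x y]. Commutation
    applied to u_r f, where u_r^2 = 0, gives y Q(x,y) = x Q(y,x), and this eliminates [Q]. *)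
Lemma row_op_double (x y : R) r n f w : x != 0 -> y != 0 ->
  (y - x) * row_op x r n.+1 (row_op y r n.+1 f) w =
  y ^+ 2 * row_op x r n.+1 (row_op y r.+1 n f) w -
  x ^+ 2 * row_op y r n.+1 (row_op x r.+1 n f) w.
Proof.
move=> x0 y0.
pose Q a b := row_op a r n.+1 (row_op b r.+1 n (nil_op r f)).
have newE (a b : R) : row_op a r n.+1 (row_op b r n.+1 f) =
    lin b (row_op a r n.+1 (row_op b r.+1 n f)) 1 (Q a b).
  rewrite -[row_op b r n.+1 f]/(row_op b r.+1 n (cell_op b r f)) cell_opE.
  by rewrite (row_op_lin b) (row_op_lin a).
have QE (a b : R) : row_op a r n.+1 (row_op b r n.+1 (nil_op r f)) =
  lin b (Q a b) 0 (Q a b).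
  rewrite -[row_op b r n.+1 _]/(row_op b r.+1 n (cell_op b r (nil_op r f)))
    -(row_op_lin a).
  rewrite -(row_op_lin b); congr (row_op a r n.+1 (row_op b r.+1 n _)).
  by apply: functional_extensionality => v; rewrite /lin /cell_op nil_op_sq;
    ring.
have eQ : y * Q x y w = x * Q y x w.
  move: (congr1 (fun F => F w) (row_op_comm r n.+1 (nil_op r f) x0 y0)).
  by rewrite !QE /lin !mul0r !addr0.
have e1 := congr1 (fun F => F w) (newE x y).
have e2 := congr1 (fun F => F w) (newE y x).
rewrite -row_op_comm // in e2; rewrite /lin !mul1r in e1 e2.
by rewrite mulrBl {1}e1 e2 !mulrDr eQ; ring.
Qed.

(** * Generating functions of networks and their recursion *)

Fixpoint rows_op m (rs : seq nat) t i f : (nat -> nat) -> R :=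
  if rs is r :: rs' then row_op (t i) r (m.+1 - r) (rows_op m rs' t i.+1 f)
    else f.

Lemma rows_op_cat m r1 r2 t i f :
  rows_op m (r1 ++ r2) t i f = rows_op m r1 t i (rows_op m r2 t (i +
    size r1) f).
Proof.
elim: r1 i => [|r r1 IH] i /=; first by rewrite addn0.
by rewrite IH addSnnS.
Qed.

Lemma rows_op_lin m rs t i b f c g :
  rows_op m rs t i (lin b f c g) = lin b (rows_op m rs t i f) c (rows_op m rs t
    i g).
Proof. by elim: rs i => //= r rs IH i; rewrite IH row_op_lin. Qed.

Lemma eq_rows_op m rs t t' i f :
  (forall j, (i <= j < i + size rs)%N -> t j = t' j) ->
  rows_op m rs t i f = rows_op m rs t' i f.
Proof.
elim: rs i => //= r rs IH i ht; rewrite ht; last by lia.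
by rewrite IH // => j hj; apply: ht; lia.
Qed.

(** Simulation principle: a row commutes with a shift of positions that preserves comparisons. It
    lets a position already holding its final value be forgotten. *)
Lemma row_op_rel (d lo hi : nat) (Rel : (nat -> nat) -> (nat -> nat) -> Prop)
    a r n f g :
  (forall j w w', (lo <= j < hi)%N -> Rel w w' ->
     (w (j + d).+1 < w (j + d))%N = (w' j.+1 < w' j)%N /\
     Rel (swap (j + d) w) (swap j w')) ->
  (forall w w', Rel w w' -> f w = g w') ->
  (lo <= r)%N -> (r + n <= hi)%N ->
  forall w w', Rel w w' -> row_op a (r + d) n f w = row_op a r n g w'.
Proof.
move=> hRel; elim: n r f g => [|n IH] r f g hfg lor hir w w' hw /=.
  exact: hfg.
rewrite -addSn; apply: IH => //; try lia.
move=> v v' hv; rewrite /cell_op /nil_op.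
have /hRel-/(_ _ _ hv) [e hs] : (lo <= r < hi)%N by lia.
by rewrite e (hfg _ _ hv); case: ifP => // _; rewrite (hfg _ _ hs).
Qed.

Lemma rows_op_rel (d lo m : nat) (Rel : (nat -> nat) -> (nat -> nat) -> Prop)
    rs t i f g :
  (forall j w w', (lo <= j <= m)%N -> Rel w w' ->
     (w (j + d).+1 < w (j + d))%N = (w' j.+1 < w' j)%N /\
     Rel (swap (j + d) w) (swap j w')) ->
  (forall w w', Rel w w' -> f w = g w') ->
  all (leq lo) rs ->
  forall w w', Rel w w' ->
  rows_op (m + d) [seq (r + d)%N | r <- rs] t i f w = rows_op m rs t i g w'.
Proof.
move=> hRel hfg; elim: rs i => [|r rs IH] i /=; first by move=> _; exact: hfg.
case/andP=> lor hrs w w' hw.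
rewrite (_ : ((m + d).+1 - (r + d) = m.+1 - r)%N); last by lia.
case: (leqP r m.+1) => hr.
  apply: (@row_op_rel d lo m.+1 Rel) => //; last by lia.
  by move=> v v' hv; apply: IH.
by rewrite (_ : (m.+1 - r = 0)%N) /=; [apply: IH|lia].
Qed.

Definition is_identity m w := all (fun i => w i == i) (iota 1 m.+1).
Definition delta m : (nat -> nat) -> R := fun w => (is_identity m w)%:R.
Definition reversal m : nat -> nat := fun i => (m.+2 - i)%N.

(** Compared with [network_gf], rows s+2 to k+1 stop at position 2; raising s releases them one by
    one down to position 1. *)
Definition released_network_gf k m s t : R :=
  rows_op m (nseq s.+1 1%N ++ nseq (k - s) 2 ++ iota 2 m.-1) t 1 (delta m)
    (reversal m).
Definition network_gf k m t : R := rows_op m (nseq k 1%N ++ iota 1 m) t 1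
  (delta m) (reversal m).

(** Rows s+1 and s+2 are adjacent and, once released, both end at position 1, so [row_op_double]
    applies to them; all other rows are free of their two variables. *)
Lemma released_network_gf_step k m s t : (0 < m)%N -> (s < k)%N ->
  t s.+1 != 0 -> t s.+2 != 0 ->
  (t s.+2 - t s.+1) * released_network_gf k m s.+1 t =
  t s.+2 ^+ 2 * released_network_gf k m s t - t s.+1 ^+ 2 *
    released_network_gf k m s (swap s.+1 t).
Proof.
case: m => // m _ lsk n0 n1.
pose post := nseq (k - s.+1) 2 ++ iota 2 m.
pose Z := rows_op m.+1 post t s.+3 (delta m.+1).
pose N := row_op (t s.+1) 1 m.+1 (row_op (t s.+2) 1 m.+1 Z).
pose O (x y : R) := row_op x 1 m.+1 (row_op y 2 m Z).
have e : lin (t s.+2 - t s.+1) N 0 N =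
   lin (t s.+2 ^+ 2) (O (t s.+1) (t s.+2)) (- t s.+1 ^+ 2) (O (t s.+2) (t
     s.+1)).
  apply: functional_extensionality => w; rewrite /lin mul0r addr0 /N /O.
  by rewrite row_op_double // mulNr.
have newE : released_network_gf k m.+1 s.+1 t =
  rows_op m.+1 (nseq s 1%N) t 1 N (reversal m.+1).
  rewrite /released_network_gf (_ : nseq s.+2 1%N = nseq s 1%N ++ [:: 1;
    1]%N); last first.
    by rewrite -[[:: 1; 1]%N]/(nseq 2 1%N) -nseqD addn2.
  by rewrite -catA rows_op_cat size_nseq add1n.
have oldE t' : released_network_gf k m.+1 s t' = rows_op m.+1 (nseq s 1%N) t' 1
    (row_op (t' s.+1) 1 m.+1 (row_op (t' s.+2) 2 (m.+2 - 2)
       (rows_op m.+1 post t' s.+3 (delta m.+1)))) (reversal m.+1).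
  rewrite /released_network_gf (_ : nseq s.+1 1%N = nseq s 1%N ++ [:: 1%N]);
    last first.
    by rewrite -[RHS](nseqD s 1) addn1.
  rewrite (_ : (k - s = (k - s.+1).+1)%N); last by lia.
  by rewrite -catA rows_op_cat size_nseq add1n.
rewrite newE !oldE swapjj swapjS !subSS subn0.
have -> : rows_op m.+1 post (swap s.+1 t) s.+3 (delta m.+1) = Z.
  by apply: eq_rows_op => j hj; rewrite swap_out //; lia.
rewrite (@eq_rows_op _ (nseq s 1%N) (swap s.+1 t) t); last first.
  by move=> j; rewrite size_nseq => hj; rewrite swap_out //; lia.
move: (congr1 (fun F => rows_op m.+1 (nseq s 1%N) t 1 F (reversal m.+1)) e).
by rewrite !rows_op_lin /lin mul0r addr0 mulNr.
Qed.

Definition rotate_first n w : nat -> nat := fun i =>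
  if i == 1%N then w n.+1 else if (1 < i <= n.+1)%N then w i.-1 else w i.

(** The row permutes only the positions 1 to n+1, so it cannot bring the value 1 to position 1 from
    elsewhere. *)
Lemma row_op_vanish a n f w : (forall v, v 1%N != 1%N -> f v = 0) ->
  (forall i, (1 <= i <= n.+1)%N -> w i != 1%N) -> row_op a 1 n f w = 0.
Proof.
move=> hf; elim: n w => [|n IH] w hw; first exact/hf/hw.
rewrite row_opS_top /cell_op /nil_op IH; last by move=> i hi; apply: hw; lia.
rewrite mulr0 add0r; case: ifP => // _; apply: IH => i hi; rewrite /swap.
by case: (i == _); [|case: (i == _)]; apply: hw; lia.
Qed.

(* Only the all-swap term of the row can carry the value 1 to position 1. *)
Lemma row_op_rotate a n f w : (forall v, v 1%N != 1%N -> f v = 0) ->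
  w n.+1 = 1%N -> (forall i, (1 <= i <= n)%N -> (1 < w i)%N) ->
  row_op a 1 n f w = f (rotate_first n w).
Proof.
move=> hf; elim: n w => [|n IH] w w1 hw.
  congr f; apply: functional_extensionality => i; rewrite /rotate_first.
  by case: eqP => [->|_] //; case: ifP => //; lia.
rewrite row_opS_top /cell_op /nil_op row_op_vanish //; last first.
  by move=> i hi; rewrite neq_ltn hw ?orbT //; lia.
rewrite mulr0 add0r add1n w1 hw ?ltnSn // IH.
- congr f; apply: functional_extensionality => i; rewrite /rotate_first /swap.
  by do !(case: eqP => ?); do ?case: ifP; try lia; move=> *; congr w; lia.
- by rewrite swapjj.
by move=> i hi; rewrite swap_out ?hw //; lia.
Qed.

Lemma cell_op_vanish a j f : (1 < j)%N -> (forall v, v 1%N != 1%N -> f v = 0) ->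
  forall v, v 1%N != 1%N -> cell_op a j f v = 0.
Proof.
move=> j1 hf v hv; rewrite /cell_op /nil_op hf // mulr0 add0r;
  case: ifP => // _.
by apply: hf; rewrite swap_out //; lia.
Qed.

Lemma rows_op_vanish m rs t i f : all (leq 2) rs ->
  (forall v, v 1%N != 1%N -> f v = 0) ->
  forall v, v 1%N != 1%N -> rows_op m rs t i f v = 0.
Proof.
move=> + hf; elim: rs i => [|r rs IH] i //= /andP[r2 hrs].
move: (rows_op m rs t i.+1 f) (IH i.+1 hrs) (m.+1 - r)%N => g hg n.
elim: n r r2 g hg => //= n IHn r r2 g hg.
by apply: IHn; [lia | apply: cell_op_vanish].
Qed.

(** Only the first row reaches position 1, so it must swap throughout to carry the value 1 there and
    contributes no variable. The other rows form the network with one position fewer and labels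
    raised by one. *)
Lemma released_network_gf_base k m t : released_network_gf k m.+1 0 t =
  network_gf k m (fun i => t i.+1).
Proof.
rewrite /released_network_gf /network_gf subn0.
rewrite [LHS](_ : _ = row_op (t 1%N) 1 m.+1
  (rows_op m.+1 (nseq k 2 ++ iota 2 m) t 2 (delta m.+1)) (reversal m.+1)) //.
have d1 v : v 1%N != 1%N -> delta m.+1 v = 0.
  by rewrite /delta /is_identity /= => /negbTE ->.
have h2 : all (leq 2) (nseq k 2 ++ iota 2 m).
  by apply/allP => x; rewrite mem_cat mem_nseq mem_iota; lia.
rewrite row_op_rotate; first last.
- by rewrite /reversal => i; lia.
- by rewrite /reversal; lia.
- exact: rows_op_vanish.
have -> : nseq k 2 ++ iota 2 m = [seq (r + 1)%N | r <- nseq k 1%N ++ iota 1 m].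
  rewrite map_cat map_nseq; congr (_ ++ _).
  by rewrite (iotaDl 1 1); apply: eq_map => x; rewrite addn1.
have tE rs i f : rows_op m rs (fun i => t i.+1) i f = rows_op m rs t i.+1 f.
  by elim: rs i => //= r rs IH i; rewrite IH.
rewrite tE -{1}[m.+1]addn1.
pose Rel w w' := w 1%N = 1%N /\
  forall i, (1 <= i <= m.+1)%N -> w i.+1 = (w' i).+1.
apply: (@rows_op_rel 1 1 m Rel).
- move=> j w w' hj [w1 hw]; rewrite addn1 !hw ?ltnS; try lia; split=> //.
  split; first by rewrite swap_out //; lia.
  by move=> i hi; rewrite /swap !eqSS; do !case: eqP => _; rewrite ?hw //; lia.
- move=> w w' [w1 hw]; rewrite /delta /is_identity; congr (_%:R);
  congr nat_of_bool.
  rewrite -[iota 1 m.+2]/(1%N :: iota 2 m.+1) /= w1 eqxx /=.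
  rewrite -[_ && _]/(all _ (iota 2 m.+1)) -[_ && _]/(all _ (iota 1 m.+1)).
  rewrite (iotaDl 1 1) all_map; apply: eq_in_all => i; rewrite mem_iota => hi.
  by rewrite /= add1n hw ?eqSS //; lia.
- by apply/allP => x; rewrite mem_cat mem_nseq mem_iota; lia.
split=> [|i hi]; rewrite /rotate_first /reversal; first by rewrite eqxx; lia.
by case: eqP; [lia | case: ifP; lia].
Qed.

Lemma released_network_gf_all k m t : (0 < m)%N ->
  released_network_gf k m k t = network_gf k m t.
Proof.
case: m => // m _; rewrite /released_network_gf /network_gf subnn /=.
by rewrite -cat1s catA -[[:: 1%N]]/(nseq 1 1%N) -nseqD addn1.
Qed.

End Operators.

(** * Fans of lattice paths *)

(* Paths are lists of column heights, the last column first. *)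
Fixpoint wpaths (c q : nat) : seq (seq nat) :=
  if c is c'.+1 then flatten [seq [seq h :: p | p <- wpaths c' h] | h <- iota 0
    q.+1]
  else [:: [::]].

Lemma wpathsS c q :
  wpaths c.+1 q = flatten [seq [seq h :: p | p <- wpaths c h] | h <- iota 0
    q.+1].
Proof. by []. Qed.

Lemma wpathsP c q p :
  reflect (size p = c /\ path geq q p) (p \in wpaths c q).
Proof.
elim: c q p => [|c IH] q p.
  by rewrite inE; apply: (iffP eqP) => [->//|[/size0nil->]].
rewrite wpathsS; apply: (iffP flatten_mapP) => [[h hq /mapP[p' /IH[sp pp]
  ->]]|].
  rewrite /= sp; move: hq; rewrite mem_iota /= => hq; split=> //.
  by apply/andP; split=> //; lia.
case: p => [|h p]; first by case.
move=> [[sp] /andP[hq pp]].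
exists h; first by rewrite mem_iota; lia.
by apply/mapP; exists p => //; apply/IH.
Qed.

Lemma wpaths_le c q p h : p \in wpaths c q -> h \in p -> (h <= q)%N.
Proof.
case/wpathsP=> _; rewrite path_sortedE; last by move=> a b d; rewrite /geq /=;
  lia.
by case/andP=> /allP hp _ /hp.
Qed.

Lemma wpaths_uniq c q : uniq (wpaths c q).
Proof.
elim: c q => // c IH q; rewrite wpathsS.
elim: (iota 0 q.+1) (iota_uniq 0 q.+1) => //= h s IHs /andP[hs us].
rewrite cat_uniq IHs // map_inj_uniq ?IH //; last by move=> a b [].
rewrite andbT; apply/hasPn => p /flatten_mapP[h' h's /mapP[p' _ ->]].
by apply/negP => /mapP[p'' _ [e _]]; move: hs; rewrite -e h's.
Qed.

Section Fans.
Variable R : idomainType.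
Implicit Types (t z : nat -> R) (x y : R) (f g : nat -> nat -> nat -> R).

Lemma big_wpaths c q (F : seq nat -> R) :
  \sum_(p <- wpaths c.+1 q) F p = \sum_(h <- iota 0 q.+1) \sum_(p <- wpaths c
    h) F (h :: p).
Proof.
rewrite wpathsS big_flatten big_map; apply: eq_bigr => h _.
by rewrite big_map.
Qed.

(** [x] and [y] weigh upper and lower contacts, [z p] a free step at height p; [e] gathers what does
    not depend on p, including both contacts when the bounds coincide. *)
Definition contact_weight x y z u l (e : R) p : R :=
  if u == l then e else e * (if p == u then x else if p == l then y else z p).

Fixpoint path_sum x y z (cols : seq (nat * nat * R)) q : R :=
  if cols is (u, l, e) :: cs then
    \sum_(p <- iota 0 q.+1) (if (l <= p <= u)%N then contact_weight x y z u l e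
      p else 0)
       * path_sum x y z cs p
  else 1.

Definition top_height (cols : seq (nat * nat * R)) := if cols is (u, _,
  _) :: _ then u else 0%N.
Definition bot_height (cols : seq (nat * nat * R)) := if cols is (_, l,
  _) :: _ then l else 0%N.

Fixpoint dec_cols (cols : seq (nat * nat * R)) : bool :=
  if cols is (u, l, _) :: cs then
    [&& (top_height cs <= u)%N, (bot_height cs <= l)%N & dec_cols cs] else true.

Lemma path_sumS x y z u l e cs q : path_sum x y z ((u, l, e) :: cs) q.+1 =
  path_sum x y z ((u, l, e) :: cs) q +
  (if (l <= q.+1 <= u)%N then contact_weight x y z u l e q.+1 else 0) *
    path_sum x y z cs q.+1.
Proof.
rewrite -[LHS]/(\sum_(p <- iota 0 q.+2) _ * path_sum x y z cs p).
by rewrite -[q.+2]addn1 iotaD big_cat big_seq1.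
Qed.

Lemma path_sum_lt x y z u l e cs q : (q < l)%N ->
  path_sum x y z ((u, l, e) :: cs) q = 0.
Proof.
move=> lq; rewrite -[LHS]/(\sum_(p <- iota 0 q.+1) _ * path_sum x y z cs p).
rewrite big1_seq // => p /andP[_]; rewrite mem_iota => hp.
by case: ifP; [lia | rewrite mul0r].
Qed.

Lemma path_sum_bot x y z u l e cs : (l < u)%N ->
  path_sum x y z ((u, l, e) :: cs) l = e * y * path_sum x y z cs l.
Proof.
move=> lu; rewrite -[LHS]/(\sum_(p <- iota 0 l.+1) _ * path_sum x y z cs p).
rewrite -[l.+1]addn1 iotaD big_cat big_seq1 big1_seq ?add0r ?add0n.
  by rewrite leqnn ltnW //= /contact_weight gtn_eqF // ltn_eqF // eqxx add0r.
move=> p /andP[_]; rewrite mem_iota => hp.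
by case: ifP; [lia | rewrite mul0r].
Qed.

Lemma path_sum_eq x y z u e cs q : (u <= q)%N ->
  path_sum x y z ((u, u, e) :: cs) q = e * path_sum x y z cs u.
Proof.
elim: q => [|q IH] uq.
  have -> : u = 0%N by lia.
  by rewrite /= big_seq1 /contact_weight eqxx.
rewrite path_sumS; case: (ltnP q u) => uq'.
  have -> : u = q.+1 by lia.
  by rewrite path_sum_lt // leqnn /= add0r /contact_weight eqxx.
by rewrite IH //; case: ifP; [lia | rewrite mul0r addr0].
Qed.

(* [x] and [y] are the variables of the upper and lower contacts. The second  *)
(* identity is what propagates through one more column, and its value at the   *)
(* top height gives the first one for the next column.                         *)
Lemma path_sum_exchange x y z cols : dec_cols cols ->
  (forall q, (top_height cols <= q)%N -> path_sum x y z cols q =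
    path_sum y x z cols q) /\
  (forall q, (bot_height cols <= q)%N ->
     (y - z q.+1) * path_sum x y z cols q.+1 - (x - z q.+1) *
       path_sum y x z cols q.+1 =
     y * path_sum x y z cols q - x * path_sum y x z cols q).
Proof.
elim: cols => [|[[u l] e] cs IH]; first by move=> _; split=> // q _ /=; ring.
rewrite [dec_cols _]/= => /and3P[huu hll /IH[IH1 IH2]].
set S := path_sum x y z ((u, l, e) :: cs);
  set S' := path_sum y x z ((u, l, e) :: cs).
rewrite /top_height /bot_height.
case: (ltngtP l u) => [lu|ul|elu]; last first.
- have E q : (u <= q)%N -> S q = S' q.
    by move=> uq; rewrite /S /S' elu !path_sum_eq // IH1.
  split=> // q; rewrite elu => uq; rewrite !E //; last by lia.
  rewrite -!mulrBl; have -> : S' q.+1 = S' q by rewrite /S' elu !path_sum_eq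
    //; lia.
  by ring.
- have Z a b q : path_sum a b z ((u, l, e) :: cs) q = 0.
    rewrite /= big1 // => p _; case: ifP; [lia | by rewrite mul0r].
  by split=> q _; rewrite /S /S' !Z; ring.
(* Strictly below the upper bound the asymmetry of the sums is read off the remaining columns: the
   induction step is exactly the second identity for [cs]. *)
have mid q : (l <= q < u)%N ->
    S q - S' q = e * (y * path_sum x y z cs q - x * path_sum y x z cs q).
  elim: q => [|q IHq] hq.
    have l0 : l = 0%N by lia.
    by rewrite /S /S' l0 !path_sum_bot ?l0; [ring | lia | lia].
  case: (ltnP q l) => lq.
    have -> : q.+1 = l by lia.
    by rewrite /S /S' !path_sum_bot //; ring.
  have IHq' := IHq ltac:(lia).
  have i2 := IH2 q ltac:(lia).
  rewrite /S /S' !path_sumS -/S -/S' /contact_weight.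
  have -> : (l <= q.+1 <= u)%N by lia.
  have -> : (u == l) = false by lia.
  have -> : (q.+1 == u) = false by lia.
  have -> : (q.+1 == l) = false by lia.
  rewrite -[S q](subrK (S' q)) IHq'.
  move: i2; set a := path_sum x y z cs q.+1; set b := path_sum y x z cs q.+1.
  set c := path_sum x y z cs q; set d := path_sum y x z cs q; set s' := S' q.
  move=> i2.
  have -> : y * c - x * d = (y - z q.+1) * a - (x - z q.+1) * b by rewrite i2.
  by ring.
(* At the upper bound the extra upper contact, with [x] and [y] exchanged, makes up the difference
   given by [mid], so the two sums become equal. *)
have top : exists2 q, u = q.+1 & S u - S' u = 0 /\
    y * S u - x * S' u = y * S q - x * S' q.
  exists u.-1; first by lia.
  have [q eq] : exists q, u = q.+1 by exists u.-1; lia.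
  have i2 := IH2 q ltac:(lia); have m := mid q ltac:(lia).
  rewrite eq /= /S /S' !path_sumS -/S -/S' /contact_weight.
  have -> : (l <= q.+1 <= u)%N by lia.
  have -> : (u == l) = false by lia.
  rewrite -eq eqxx; have i1 := IH1 u huu.
  rewrite -eq -i1 in i2; rewrite -i1.
  split; last by ring.
  rewrite -[S q](subrK (S' q)) m -i2.
  by ring.
have const q : (u <= q)%N -> S q = S u /\ S' q = S' u.
  elim: q => [|q IHq] uq; first by have -> : u = 0%N by lia.
  case: (ltnP q u) => qu; first by have -> : u = q.+1 by lia.
  have [e1 e2] := IHq qu.
  by rewrite /S /S' !path_sumS -/S -/S' e1 e2; case: ifP;
    [lia | rewrite !mul0r !addr0].
have [qu equ [top1 top2]] := top.
have top1' : S u = S' u by apply/eqP; rewrite -subr_eq0 top1.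
have p1 q : (u <= q)%N -> S q = S' q by move=> /const[-> ->].
split=> // q lq; case: (ltngtP q.+1 u) => hq.
- have m := mid q.+1 ltac:(lia).
  have -> : (y - z q.+1) * S q.+1 - (x - z q.+1) * S' q.+1 =
    y * S q.+1 - x * S' q.+1 - z q.+1 * (S q.+1 - S' q.+1) by ring.
  rewrite m /S /S' !path_sumS -/S -/S' /contact_weight.
  have -> : (l <= q.+1 <= u)%N by lia.
  have -> : (u == l) = false by lia.
  have -> : (q.+1 == u) = false by lia.
  have -> : (q.+1 == l) = false by lia.
  by ring.
- have [-> ->] := const q.+1 ltac:(lia); have [-> ->] := const q ltac:(lia).
  by rewrite top1'; ring.
have -> : q = qu by lia.
rewrite -equ -top2 top1'; ring.
Qed.

(** Lists start with the last column, so [size P'] is the abscissa of the current column. *)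
Fixpoint pair_weight f (U P : seq nat) : R :=
  match U, P with
  | u :: U', p :: P' => (if (p <= u)%N then f (size P') u p else 0) *
    pair_weight f U' P'
  | [::], [::] => 1
  | _, _ => 0
  end.

Fixpoint mkcols (e : nat -> nat -> R) (U L : seq nat) : seq (nat * nat * R) :=
  match U, L with
  | u :: U', l :: L' => (u, l, e u l) :: mkcols e U' L'
  | _, _ => [::]
  end.

Lemma mkcols_dec e U L c q q' : U \in wpaths c q -> L \in wpaths c q' ->
  dec_cols (mkcols e U L).
Proof.
move=> /wpathsP[sU pU] /wpathsP[sL pL].
elim: c q q' U L sU sL pU pL => [|c IH] q q' [|u U] [|l L] //= [sU] [sL].
move=> /andP[qu pU] /andP[ql pL]; rewrite (IH u l) // andbT.
case: U {sU IH} pU => [|u' U] /=; case: L {sL} pL => [|l' L] //=.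
by move=> /andP[hl _] /andP[hu _]; rewrite hu hl.
Qed.

Lemma sum_pair_weight f g x y z e U L c q :
  size U = c -> size L = c ->
  (forall j u l p, (j < c)%N -> u \in U -> l \in L -> (l <= p <= u)%N ->
    (p <= q)%N ->
     f j u p * g j p l = contact_weight x y z u l (e u l) p) ->
  \sum_(P <- wpaths c q) pair_weight f U P * pair_weight g P L =
    path_sum x y z (mkcols e U L) q.
Proof.
elim: c q U L => [|c IH] q [|u U] [|l L] //.
  by move=> _ _ _; rewrite /= big_seq1 mulr1.
move=> [sU] [sL] hfg; rewrite big_wpaths.
rewrite -[RHS]/(\sum_(p <- iota 0 q.+1) _ * path_sum x y z (mkcols e U L) p).
rewrite big_seq [RHS]big_seq; apply: eq_bigr => h; rewrite mem_iota => hh.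
rewrite -(IH h U L) //; last first.
  move=> j u' l' p jc hu hl hp ph; apply: hfg => //; try lia.
  - by rewrite inE hu orbT.
  - by rewrite inE hl orbT.
rewrite big_distrr /= big_seq [RHS]big_seq; apply: eq_bigr => P /wpathsP[sP _].
rewrite /= sP sL; case hu: (h <= u)%N; case hl: (l <= h)%N;
  rewrite ?mul0r ?mulr0 //=.
rewrite -(hfg c u l h) //; rewrite ?inE ?eqxx ?hl ?hu //; try by lia.
by rewrite mulrACA.
Qed.

(** * Transfer operators and generating functions of fans *)

Definition transfer (A : seq (seq nat)) f (h : seq nat -> R) : seq nat -> R :=
  fun U => \sum_(P <- A) pair_weight f U P * h P.

Lemma eq_transfer A f h h' U : {in A, h =1 h'} ->
  transfer A f h U = transfer A f h' U.
Proof.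
by move=> e; rewrite /transfer big_seq [RHS]big_seq; apply: eq_bigr => P /e->.
Qed.

Lemma eq_foldr_transfer A fs h h' :
  {in A, h =1 h'} -> {in A, foldr (transfer A) h fs =1 foldr (transfer A) h'
    fs}.
Proof.
by elim: fs => //= f fs IH e U _; apply: eq_transfer => P /(IH e).
Qed.

Lemma transfer2 A f g h U :
  transfer A f (transfer A g h) U =
  \sum_(L <- A) (\sum_(P <- A) pair_weight f U P * pair_weight g P L) * h L.
Proof.
rewrite /transfer; under eq_bigr do rewrite big_distrr /=.
rewrite exchange_big; apply: eq_bigr => L _; rewrite big_distrl.
by apply: eq_bigr => P _; rewrite mulrA.
Qed.

Lemma foldr_transfer_lin A fs a b c h1 h2 h3 U :
  (fs = [::] -> U \in A \/ a * h1 U = b * h2 U + c * h3 U) ->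
  {in A, forall L, a * h1 L = b * h2 L + c * h3 L} ->
  a * foldr (transfer A) h1 fs U =
  b * foldr (transfer A) h2 fs U + c * foldr (transfer A) h3 fs U.
Proof.
elim: fs U => [|f fs IH] U hU h /=; first by case: (hU erefl) => [/h|].
rewrite /transfer !big_distrr -big_split /= big_seq [RHS]big_seq.
apply: eq_bigr => P PA; rewrite !(mulrCA _ (pair_weight f U P)) -mulrDr;
  congr (_ * _).
by apply: IH => //; left.
Qed.

(* The labels [l + 1] and [k + 2] of the upper and lower contacts of path [l]  *)
(* are exchanged for one [l] at a time: [l = k + 1] gives the factors of       *)
(* [path_factor] with shifted labels, and [l = 1] those of [forced_factor]     *)
(* with one more column.                                                       *)
Definition mixed_factor k n t l j : nat -> nat -> nat -> R := fun _ a b =>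
  if j == 0%N then 1 else
  if (n <= a)%N then (if (a == b) || (j < l)%N then t j.+1 else t k.+2)
  else if a == b then
    (if (l <= j)%N then t j.+1 else if j.+1 == l then t k.+2 else t j.+2)
  else t (k.+2 + (n - a))%N.

(** Path j at height m lies on T together with all earlier paths, so it touches path j-1 and carries
    t_j; below, a contact with path j+1 carries t_(j+1). Index 0 is T itself, without weight. *)
Definition path_factor k m t j : nat -> nat -> nat -> R := fun _ a b =>
  if j == 0%N then 1 else if (m <= a)%N then t j
  else if a == b then t j.+1 else t (k.+1 + (m - a))%N.

(** The last column is frozen at height m-1, where B ends, and carries no variable; the other
    columns then behave as in a fan with one column fewer. *)
Definition forced_factor k m t j : nat -> nat -> nat -> R := fun c a b =>
  if c == m.-1 then (a == m.-1)%:R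
  else if a == b then t j.+1 else t (k.+1 + (m - a))%N.

Definition top m := nseq m m.
Definition bot m := rev (iota 0 m).
Definition is_bot m : seq nat -> R := fun P => (P == bot m)%:R.

Definition released_fan_gf k m s t : R :=
  foldr (transfer (wpaths m m)) (is_bot m)
    [seq (if (s < j)%N then forced_factor k m t j else path_factor k m t j) | j
      <- iota 0 k.+1] (top m).
Definition fan_gf k m t : R :=
  foldr (transfer (wpaths m m)) (is_bot m) [seq path_factor k m t j | j <- iota
    0 k.+1] (top m).
Definition mixed_fan_gf k n t l : R :=
  foldr (transfer (wpaths n n)) (is_bot n) [seq mixed_factor k n t l j | j <-
    iota 0 k.+1] (top n).

Lemma released_fan_gf_all k m t : released_fan_gf k m k t = fan_gf k m t.
Proof.
rewrite /released_fan_gf /fan_gf; congr (foldr _ _ _ _); apply/eq_in_map => j;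
  rewrite mem_iota => hj.
by case: ifP => //; lia.
Qed.

Lemma mixed_fan_gf_shift k n t : mixed_fan_gf k n t k.+1 =
  fan_gf k n (fun i => t i.+1).
Proof.
rewrite /mixed_fan_gf /fan_gf; congr (foldr _ _ _ _); apply/eq_in_map => j;
  rewrite mem_iota => hj.
do 3!apply: functional_extensionality => ?; rewrite /mixed_factor /path_factor.
case: ifP => // _; rewrite (_ : (j < k.+1)%N) ?orbT; last by lia.
case: ifP => // _; rewrite addSn; case: ifP => // _; rewrite leqNgt.
rewrite (_ : (j < k.+1)%N) /=; last by lia.
by case: eqP => // [[->]].
Qed.

Lemma top_wpaths m : top m \in wpaths m m.
Proof.
apply/wpathsP; rewrite size_nseq; split=> //.
by rewrite /top; elim: {2}m => //= n ->; rewrite leqnn.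
Qed.

Lemma iota_split s k : (s < k)%N ->
  iota 0 k.+1 = iota 0 s ++ [:: s; s.+1] ++ iota s.+2 (k - s.+1).
Proof.
move=> sk; rewrite -[[:: s; s.+1]]/(iota s 2) -[s.+2]addn2.
by rewrite -!iotaD; congr iota; lia.
Qed.

Lemma top_height_le e n U L c : U \in wpaths c n ->
  (top_height (mkcols e U L) <= n)%N.
Proof. by case: U L => [|u U] [|l L] // /wpathsP[_ /andP[]]. Qed.

(** Between fixed neighbours, passing from l = s+2 to l = s+1 exchanges the upper and lower contact
    variables of path s+1, and the full path sum is symmetric in them. *)
Lemma mixed_factor_exchange k n t s U L : (s < k)%N -> U \in wpaths n n ->
  L \in wpaths n n ->
  (s = 0%N -> U = top n) ->
  \sum_(P <- wpaths n n) pair_weight (mixed_factor k n t s.+2 s) U P *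
    pair_weight (mixed_factor k n t s.+2 s.+1) P L =
  \sum_(P <- wpaths n n) pair_weight (mixed_factor k n t s.+1 s) U P *
    pair_weight (mixed_factor k n t s.+1 s.+1) P L.
Proof.
move=> sk hU hL hU0.
pose x := t s.+2; pose y := t k.+2; pose z p := t (k.+2 + (n - p))%N.
(* [al] is the weight of the upper path along the top height, trivial when that path is T. *)
pose al := if s == 0%N then 1 else t s.+1.
pose e u l := if u == l then (if (n <= u)%N then al * x else x * y)
              else if (n <= u)%N then al else z u.
have U0 u : u \in U -> (u <= n)%N /\ (s = 0%N -> (n <= u)%N).
  move=> uU; split; first exact: wpaths_le hU uU.
  by move/hU0 => eU; move: uU; rewrite eU mem_nseq => /andP[_ /eqP->].
have sU : size U = n by case/wpathsP: hU.
have sL : size L = n by case/wpathsP: hL.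
have D := mkcols_dec e hU hL.
rewrite (@sum_pair_weight _ _ x y z e) // ?(@sum_pair_weight _ _ y x z e) //.
- by apply: (path_sum_exchange x y z D).1; exact: top_height_le hU.
- move=> j u l p _ /U0[un us] _ hp pn;
  rewrite /mixed_factor /contact_weight /e /al.
  rewrite !ltnn !ltnSn !eqxx ?orbF ?orbT.
  case: (altP (u =P l)) => [ul|ul].
    have {hp} -> : p = u by lia.
    rewrite ul eqxx; case: (leqP n l) => nl; first by rewrite ?orbT; case: ifP.
    by case: eqP => [/us|_]; [lia | rewrite mulrC].
  case: (altP (u =P p)) => [up|up].
    rewrite -up eqxx (negbTE ul); case: (leqP n u) => nu.
      by case: ifP.
    by case: eqP => [/us|_]; [lia | rewrite mulrC].
  rewrite [p == u]eq_sym (negbTE up); have np : (n <= p)%N = false by lia.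
  rewrite np /z; case: (leqP n u) => nu; first by case: ifP.
  by case: eqP => [/us|_] //; lia.
- move=> j u l p _ /U0[un us] _ hp pn;
  rewrite /mixed_factor /contact_weight /e /al.
  rewrite (_ : (s < s.+2)%N) ?orbT; last by lia.
  rewrite (_ : (s.+1 < s.+2)%N) ?orbT; last by lia.
  rewrite (_ : (s.+2 <= s)%N = false); last by lia.
  rewrite (_ : (s.+2 <= s.+1)%N = false) ?eqxx; last by lia.
  rewrite (_ : (s.+1 == s.+2) = false); last by lia.
  case: (altP (u =P l)) => [ul|ul].
    have {hp} -> : p = u by lia.
    rewrite ul eqxx; case: (leqP n l) => nl; first by rewrite ?orbT; case: ifP.
    by case: eqP => [/us|_]; [lia | ].
  case: (altP (u =P p)) => [up|up].
    rewrite -up eqxx (negbTE ul); case: (leqP n u) => nu.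
      by case: ifP.
    by case: eqP => [/us|_]; [lia | rewrite mulrC].
  rewrite [p == u]eq_sym (negbTE up); have np : (n <= p)%N = false by lia.
  rewrite np /z; case: (leqP n u) => nu; first by case: ifP.
  by case: eqP => [/us|_] //; lia.
Qed.

Lemma mixed_fan_gf_step k n t s : (s < k)%N ->
  mixed_fan_gf k n t s.+2 = mixed_fan_gf k n t s.+1.
Proof.
move=> sk; rewrite /mixed_fan_gf (iota_split sk) !map_cat !foldr_cat /=.
have eqpsi j : j != s -> j != s.+1 -> mixed_factor k n t s.+2 j =
  mixed_factor k n t s.+1 j.
  move=> js jS; do 3!apply: functional_extensionality => ?;
    rewrite /mixed_factor.
  have -> : (j < s.+2)%N = (j < s.+1)%N by lia.
  have -> : (s.+1 < j)%N = (s < j)%N by lia.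
  by have -> : (j.+1 == s.+2) = (j.+1 == s.+1) by lia.
rewrite (_ : [seq mixed_factor k n t s.+2 j | j <- iota s.+2 _] =
   [seq mixed_factor k n t s.+1 j | j <- iota s.+2 (k - s.+1)]); last first.
  by apply/eq_in_map => j; rewrite mem_iota => hj; rewrite eqpsi //; lia.
set h := foldr _ (is_bot n) _.
rewrite (_ : [seq mixed_factor k n t s.+2 j | j <- iota 0 s] =
   [seq mixed_factor k n t s.+1 j | j <- iota 0 s]); last first.
  by apply/eq_in_map => j; rewrite mem_iota => hj; rewrite eqpsi //; lia.
have ex U : U \in wpaths n n -> (s = 0%N -> U = top n) ->
    transfer (wpaths n n) (mixed_factor k n t s.+2 s) (transfer (wpaths n n)
      (mixed_factor k n t s.+2 s.+1) h) U =
    transfer (wpaths n n) (mixed_factor k n t s.+1 s) (transfer (wpaths n n)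
      (mixed_factor k n t s.+1 s.+1) h) U.
  move=> hU h0; rewrite !transfer2 big_seq [RHS]big_seq; apply: eq_bigr => L hL.
  by rewrite mixed_factor_exchange.
have [s0|s0] := posnP s; first by rewrite s0 /= -s0; apply: ex => //;
  exact: top_wpaths.
by apply: eq_foldr_transfer; [move=> U hU; apply: ex => //;
  lia | exact: top_wpaths].
Qed.

Lemma mixed_fan_gf_all k n t : mixed_fan_gf k n t 1 =
  fan_gf k n (fun i => t i.+1).
Proof.
rewrite -mixed_fan_gf_shift; suff H s : (s <= k)%N ->
  mixed_fan_gf k n t 1 = mixed_fan_gf k n t s.+1 by exact: H.
by elim: s => // s IH sk; rewrite mixed_fan_gf_step // IH // ltnW.
Qed.

Lemma eq_pair_weight f g U P :
  (forall j u p, (j < size P)%N -> u \in U -> p \in P -> f j u p = g j u p) ->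
  pair_weight f U P = pair_weight g U P.
Proof.
elim: P U => [|p P IH] [|u U] //= hfg.
rewrite hfg ?inE ?eqxx // IH // => j v r jP vU rP.
by apply: hfg; rewrite ?inE ?vU ?rP ?orbT // ltnW.
Qed.

Lemma pair_weight1 f M P : (forall j p, p \in P -> (p <= M)%N /\ f j M p = 1) ->
  pair_weight f (nseq (size P) M) P = 1.
Proof.
elim: P => //= p P IH hf.
have [-> ->] := hf (size P) p (mem_head _ _); rewrite mul1r IH // => j r rP.
by apply: hf; rewrite inE rP orbT.
Qed.

Lemma sum_iota_single m (F : nat -> R) : (forall p, p != m -> F p = 0) ->
  \sum_(p <- iota 0 m.+2) F p = F m.
Proof.
move=> F0; rewrite -[m.+2]addn2 iotaD big_cat /= big1_seq; last first.
  by move=> p /andP[_]; rewrite mem_iota => hp; apply: F0; lia.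
by rewrite add0r big_cons big_seq1 add0n (F0 m.+1) ?addr0 //; lia.
Qed.

(** All paths are frozen in the last column, so it can be deleted; what is left is the mixed fan
    with l = 1, and the exchanges turn its labels into the shifted ones. *)
Lemma released_fan_gf_base k m t : released_fan_gf k m.+1 0 t =
  fan_gf k m (fun i => t i.+1).
Proof.
rewrite -mixed_fan_gf_all /released_fan_gf /mixed_fan_gf.
pose Q (h h' : seq nat -> R) := forall p P, P \in wpaths m p -> (p <= m.+1)%N ->
  h (p :: P) = if p == m then h' P else 0.
have Q0 : Q (is_bot m.+1) (is_bot m).
  move=> p P _ _; rewrite /is_bot /bot -addn1 iotaD rev_cat /= add0n eqseq_cons.
  by case: eqP.
have eqf j U P : (0 < j)%N -> U \in wpaths m m -> P \in wpaths m m ->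
    pair_weight (forced_factor k m.+1 t j) U P =
      pair_weight (mixed_factor k m t 1 j) U P.
  move=> j0 hU hP; apply: eq_pair_weight => c u p;
    have [-> _] := wpathsP _ _ _ hP => cm uU _.
  have um := wpaths_le hU uU.
  rewrite /forced_factor /mixed_factor eqn0Ngt j0 /= ltn_eqF // ltnS leqn0
    eqn0Ngt j0 orbF.
  rewrite subSn // addnS -addSn; case: (leqP m u) => // mu.
  by rewrite (eqP mu) addn0.
have QS j h h' : (0 < j)%N -> Q h h' ->
    Q (transfer (wpaths m.+1 m.+1) (forced_factor k m.+1 t j) h) (transfer
      (wpaths m m) (mixed_factor k m t 1 j) h').
  move=> j0 hQ u U hU um; rewrite /transfer big_wpaths sum_iota_single;
    last first.
    move=> p pm; rewrite big_seq big1 // => P hP.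
    case: (leqP p m.+1) => pm1; last by rewrite /= ifF ?mul0r //; lia.
    by rewrite hQ // (negbTE pm) mulr0.
  rewrite big_seq; case: eqP => [um'|um'].
    rewrite big_seq; apply: eq_bigr => P hP.
    rewrite hQ // eqxx /= um' leqnn; have [-> _] := wpathsP _ _ _ hP.
    rewrite [forced_factor k m.+1 t j m m m](_ : _ = 1);
      last by rewrite /forced_factor !eqxx.
    by rewrite mul1r eqf // -[X in wpaths _ X]um'.
  rewrite big1 // => P hP /=; have [-> _] := wpathsP _ _ _ hP.
  by rewrite /forced_factor /= eqxx; case: eqP => // _; case: ifP;
    rewrite !mul0r.
have fc A f fs h U : foldr (transfer A) h (f :: fs) U =
  transfer A f (foldr (transfer A) h fs) U by [].
rewrite -[iota 0 k.+1]/(0%N :: iota 1 k) !map_cons !fc.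
have Qall : Q (foldr (transfer (wpaths m.+1 m.+1)) (is_bot m.+1)
       [seq (if (0 < j)%N then forced_factor k m.+1 t j else path_factor k m.+1
         t j) | j <- iota 1 k])
     (foldr (transfer (wpaths m m)) (is_bot m) [seq mixed_factor k m t 1 j | j
       <- iota 1 k]).
  have : all (leq 1) (iota 1 k) by apply/allP => x; rewrite mem_iota; lia.
  elim: (iota 1 k) => //= j s IH /andP[j0 hs]; rewrite j0; apply: QS => //.
  exact: IH.
move: Qall; set h := foldr _ _ _; set h' := foldr _ _ _ => Qall.
rewrite /transfer big_wpaths sum_iota_single; last first.
  move=> p pm; rewrite big_seq big1 // => P hP.
  case: (leqP p m.+1) => pm1; last by rewrite /= ifF ?mul0r //; lia.
  by rewrite Qall // (negbTE pm) mulr0.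
rewrite big_seq [RHS]big_seq; apply: eq_bigr => P hP.
rewrite Qall // eqxx; have [sP _] := wpathsP _ _ _ hP.
have le q := @wpaths_le _ _ _ q hP.
have p1 f M (P' : seq nat) n : size P' = n ->
    (forall j p, p \in P' -> (p <= M)%N /\ f j M p = 1) ->
      pair_weight f (nseq n M) P' = 1.
  by move=> <-; exact: pair_weight1.
rewrite /top !p1 ?sP //= ?sP // => j p; first by move/le.
by rewrite inE => /predU1P[->|/le pm]; split=> //; lia.
Qed.

(** A frozen path, like B itself, ends at height c; the paths after the one being released therefore
    vanish on any other end. *)
Lemma forced_factor_head k c (fs : seq (nat -> nat -> nat -> R)) t l L :
  size L = c -> l != c ->
  (fs = [::] \/ exists j fs', fs = forced_factor k c.+1 t j :: fs') ->
  foldr (transfer (wpaths c.+1 c.+1)) (is_bot c.+1) fs (l :: L) = 0.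
Proof.
move=> sL lc [->|[j [fs' ->]]].
  rewrite [LHS]/= /is_bot /bot -addn1 iotaD rev_cat /= add0n eqseq_cons.
  by rewrite (negbTE lc).
rewrite -[LHS]/(transfer _ _ _ _) /transfer big_seq big1 // => -[|p P]
  /wpathsP[//].
move=> [sP] _ /=; rewrite sP /forced_factor eqxx (negbTE lc).
by case: ifP; rewrite !mul0r.
Qed.

(** The path analogue of [row_op_double]: path s+1 is summed between fixed neighbours, with its last
    column free on the left and frozen on the right. *)
Lemma path_factor_exchange k c s t t' U L : (s < k)%N ->
  U \in wpaths c.+1 c.+1 -> c :: L \in wpaths c.+1 c.+1 -> (s = 0%N ->
    U = top c.+1) ->
  t' = swap s.+1 t ->
  (t s.+2 - t s.+1) *
    \sum_(P <- wpaths c.+1 c.+1)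
      pair_weight (path_factor k c.+1 t s) U P *
        pair_weight (path_factor k c.+1 t s.+1) P (c :: L) =
  t s.+2 ^+ 2 * \sum_(P <- wpaths c.+1 c.+1)
      pair_weight (path_factor k c.+1 t s) U P *
        pair_weight (forced_factor k c.+1 t s.+1) P (c :: L) +
  - t s.+1 ^+ 2 * \sum_(P <- wpaths c.+1 c.+1)
      pair_weight (path_factor k c.+1 t' s) U P *
        pair_weight (forced_factor k c.+1 t' s.+1) P (c :: L).
Proof.
move=> sk hU hL U0 et'.
pose x := t s.+1; pose y := t s.+2; pose z p := t (k.+1 + (c.+1 - p))%N.
pose al := if s == 0%N then 1 else t s.
pose e u l := if u == l then x * y else if (c.+1 <= u)%N then al else z u.
have Ule u : u \in U -> (u <= c.+1)%N /\ (s = 0%N -> (c.+1 <= u)%N).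
  move=> uU; split; first exact: wpaths_le hU uU.
  by move/U0 => eU; move: uU; rewrite eU mem_nseq => /andP[_ /eqP->].
have Lle l : l \in L -> (l <= c)%N.
  by have [/= _ /andP[_ pL]] := wpathsP _ _ _ hL; apply: (@wpaths_le c c);
    apply/wpathsP;
     split=> //; case/wpathsP: hL => [[]].
have weight (t1 : nat -> R) x1 y1 : t1 s.+1 = x1 -> t1 s.+2 = y1 ->
  x1 * y1 = x * y ->
    (s = 0%N \/ t1 s = t s) -> (forall p, (p <= c)%N ->
      t1 (k.+1 + (c.+1 - p))%N = z p) ->
    forall j u l p, u \in U -> (l <= c)%N -> (l <= p <= u)%N ->
    path_factor k c.+1 t1 s j u p * path_factor k c.+1 t1 s.+1 j p l =
      contact_weight x1 y1 z u l (e u l) p.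
  move=> ex ey exy es ez j u l p uU lc hp; have [uc us] := Ule _ uU.
  rewrite /path_factor /contact_weight /e ex ey /=.
  case: (altP (u =P l)) => [ul|ul].
    have {hp} -> : p = u by lia.
    rewrite ul eqxx ltnNge lc /=; case: eqP => [/us|_]; first by lia.
    by rewrite exy.
  rewrite /al; have [pc|pc] := ltnP c p.
    have pu : p = u by lia.
    rewrite pu in pc *; rewrite eqxx pc.
    by case: eqP es => // s0 [] // ->.
  case: (altP (p =P u)) => [pu|pu].
    rewrite -pu eqxx ltnNge pc /=; rewrite pu (negbTE ul) -pu ez //.
    by case: eqP => [/us|_]; [lia | rewrite mulrC].
  rewrite (ez p) //; have [uc'|uc'] := ltnP c u.
    by case: eqP es => // s0 [] // ->.
  rewrite [u == p]eq_sym (negbTE pu) ez //.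
  by case: eqP => [/us|_] //; lia.
have fOA t1 j p l : (j < c)%N -> (p <= c)%N ->
    forced_factor k c.+1 t1 s.+1 j p l = path_factor k c.+1 t1 s.+1 j p l.
  by move=> jc pc; rewrite /forced_factor /path_factor /= ltn_eqF // ltnNge pc.
have w1 := weight t x y erefl erefl erefl (or_intror erefl) (fun p _ => erefl).
have a1 : t' s.+1 = y by rewrite et' swapjj.
have a2 : t' s.+2 = x by rewrite et' swapjS.
have a3 : t' s = t s by rewrite et' swap_out //; lia.
have a4 p : (p <= c)%N -> t' (k.+1 + (c.+1 - p))%N = z p.
  by move=> pc; rewrite et' swap_out //; lia.
have w2 := weight t' y x a1 a2 (mulrC y x) (or_intror a3) a4.
case: U hU U0 Ule w1 w2 {weight} => [/wpathsP[]//|u U] hU U0 Ule w1 w2.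
have [[sU] /andP[/= uc pU]] := wpathsP _ _ _ hU.
have [[sL] /andP[/= _ pL]] := wpathsP _ _ _ hL.
have hU' : U \in wpaths c u by apply/wpathsP.
have hL' : L \in wpaths c c by apply/wpathsP.
have D := mkcols_dec e hU' hL'.
have SA q : \sum_(P <- wpaths c q) pair_weight (path_factor k c.+1 t s) U P *
  pair_weight (path_factor k c.+1 t s.+1) P L
    = path_sum x y z (mkcols e U L) q.
  apply: sum_pair_weight => // j v l p _ vU /Lle lc hp _; apply: w1 => //.
  by rewrite inE vU orbT.
have SO : \sum_(P <- wpaths c c) pair_weight (path_factor k c.+1 t s) U P *
  pair_weight (forced_factor k c.+1 t s.+1) P L
    = path_sum x y z (mkcols e U L) c.
  apply: sum_pair_weight => // j v l p jc vU /Lle lc hp pc; rewrite fOA //;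
    apply: w1 => //.
  by rewrite inE vU orbT.
have SB : \sum_(P <- wpaths c c) pair_weight (path_factor k c.+1 t' s) U P *
  pair_weight (forced_factor k c.+1 t' s.+1) P L
    = path_sum y x z (mkcols e U L) c.
  apply: sum_pair_weight => // j v l p jc vU /Lle lc hp pc; rewrite fOA //;
    apply: w2 => //.
  by rewrite inE vU orbT.
(* The lower neighbour ends at height c, so the middle path ends at c or c+1. *)
have split2 (f g : nat -> nat -> nat -> R) :
   \sum_(P <- wpaths c.+1 c.+1) pair_weight f (u :: U) P *
     pair_weight g P (c :: L) =
   \sum_(h <- [:: c; c.+1]) (if (h <= u)%N then f c u h * g c h c else 0) *
      \sum_(P <- wpaths c h) pair_weight f U P * pair_weight g P L.
  rewrite big_wpaths -[c.+2]addn2 iotaD big_cat /= big1_seq ?add0r; last first.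
    move=> h /andP[_]; rewrite mem_iota => hh; rewrite big1 // => P _.
    by rewrite [(c <= h)%N]leqNgt (_ : (h < c)%N) /= ?mul0r ?mulr0 //; lia.
  rewrite add0n big_seq [RHS]big_seq; apply: eq_bigr => h; rewrite !inE => hh.
  rewrite big_distrr /= big_seq [RHS]big_seq;
    apply: eq_bigr => P /wpathsP[-> _].
  rewrite sL (_ : (c <= h)%N); last by lia.
  by case: ifP => _; rewrite ?mul0r // mulrACA.
rewrite !split2 !big_cons !big_nil !addr0 !SA SO SB.
have fO1 t1 : forced_factor k c.+1 t1 s.+1 c c.+1 c =
  0 by rewrite /forced_factor /= eqxx gtn_eqF.
have fO2 t1 : forced_factor k c.+1 t1 s.+1 c c c =
  1 by rewrite /forced_factor /= !eqxx.
rewrite !fO1 !fO2 !mulr0 !if_same !mul0r !addr0 !mulr1.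
have [uS us] := Ule u (mem_head _ _).
have [H1 H2] := path_sum_exchange x y z D.
have hu : (top_height (mkcols e U L) <= u)%N by apply: top_height_le hU'.
have hl : (bot_height (mkcols e U L) <= c)%N.
  by case: (U) (L) Lle => [|? ?] [|l ?] //=; apply; rewrite inE eqxx.
(* If the upper path ends at c+1, both ends occur and both identities of [path_sum_exchange] enter.
   If it ends at c, the middle path is squeezed and symmetry alone suffices. *)
have [cu|uc'|eu] := ltngtP u c; first by rewrite /=; ring.
  have {uc uc'} eu : u = c.+1 by lia.
  have i1 := H1 c.+1 ltac:(lia); have i2 := H2 c hl.
  rewrite -i1 in i2.
  have w1' := w1 c u c; have w2' := w2 c u c.
  have e1 : path_factor k c.+1 t s c u c = al by rewrite /path_factor eu leqnn.
  have e2 : path_factor k c.+1 t' s c u c = al.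
    rewrite /path_factor eu leqnn et' /al; case: eqP => // _;
      rewrite swap_out //; lia.
  have e3 : path_factor k c.+1 t s c u c.+1 =
    al by rewrite /path_factor eu leqnn.
  have e4 : path_factor k c.+1 t s.+1 c c c =
    y by rewrite /path_factor /= ltnn eqxx.
  have e5 : path_factor k c.+1 t s.+1 c c.+1 c =
    x by rewrite /path_factor /= leqnn.
  rewrite e1 e2 e3 e4 e5 -/x -/y.
  move: i2; set a := path_sum _ _ _ _ c.+1; set b := path_sum _ _ _ _ c.
  set d := path_sum _ _ _ _ c => i2.
  have i3 : (y - x) * a = y * b - x * d by rewrite -i2; ring.
  transitivity (al * y * (y - x) * b + al * x * ((y - x) * a)); first by ring.
  by rewrite i3; ring.
have i1 := H1 c ltac:(lia).
have s0 : (s == 0%N) = false by apply/eqP => /us; lia.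
rewrite /= mul0r addr0 eu.
have e1 : path_factor k c.+1 t s c c c = x by rewrite /path_factor s0 ltnn eqxx.
have e2 : path_factor k c.+1 t' s c c c =
  y by rewrite /path_factor s0 ltnn eqxx et' swapjj.
have e4 : path_factor k c.+1 t s.+1 c c c =
  y by rewrite /path_factor /= ltnn eqxx.
by rewrite e1 e2 e4 -i1 -/x -/y; ring.
Qed.

Arguments wpaths : simpl never.

Lemma released_fan_gf_step k m s t : (0 < m)%N -> (s < k)%N ->
  (t s.+2 - t s.+1) * released_fan_gf k m s.+1 t =
  t s.+2 ^+ 2 * released_fan_gf k m s t - t s.+1 ^+ 2 *
    released_fan_gf k m s (swap s.+1 t).
Proof.
case: m => // c _ sk; rewrite -mulNr /released_fan_gf (iota_split sk) !map_cat
  !foldr_cat.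
pose t' := swap s.+1 t; rewrite -/t'.
pose pre t1 := [seq path_factor k c.+1 t1 j | j <- iota 0 s].
pose post t1 := [seq forced_factor k c.+1 t1 j | j <- iota s.+2 (k - s.+1)].
have preE s1 t1 : (s <= s1)%N ->
   [seq (if (s1 < j)%N then forced_factor k c.+1 t1 j else path_factor k c.+1
     t1 j) | j <- iota 0 s] = pre t1.
  move=> ss; apply/eq_in_map => j; rewrite mem_iota => hj.
  by case: ifP => //; lia.
have postE s1 t1 : (s1 <= s.+1)%N ->
   [seq (if (s1 < j)%N then forced_factor k c.+1 t1 j else path_factor k c.+1
     t1 j) | j <- iota s.+2 (k - s.+1)]
   = post t1.
  move=> ss; apply/eq_in_map => j; rewrite mem_iota => hj.
  by case: ifP => //; lia.
rewrite !preE ?postE // {preE postE}; try lia.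
have -> : pre t' = pre t.
  apply/eq_in_map => j; rewrite mem_iota => hj.
  do 3!apply: functional_extensionality => ?; rewrite /path_factor /t'.
  case: eqP => // _; case: leqP => h; last by rewrite swap_out //; lia.
  by case: eqP => _; rewrite swap_out //; lia.
have -> : post t' = post t.
  apply/eq_in_map => j; rewrite mem_iota => hj.
  do 3!apply: functional_extensionality => ?; rewrite /forced_factor /t'.
  by case: eqP => // _; case: eqP => _; rewrite swap_out //; lia.
set H := foldr _ (is_bot c.+1) (post t).
rewrite /= !ltnn ltnSn (_ : (s.+1 < s)%N = false); last by lia.
have ex U : U \in wpaths c.+1 c.+1 -> (s = 0%N -> U = top c.+1) ->
  (t s.+2 - t s.+1) * transfer (wpaths c.+1 c.+1) (path_factor k c.+1 t s)
      (transfer (wpaths c.+1 c.+1) (path_factor k c.+1 t s.+1) H) U =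
  t s.+2 ^+ 2 * transfer (wpaths c.+1 c.+1) (path_factor k c.+1 t s)
      (transfer (wpaths c.+1 c.+1) (forced_factor k c.+1 t s.+1) H) U +
  - t s.+1 ^+ 2 * transfer (wpaths c.+1 c.+1) (path_factor k c.+1 t' s)
      (transfer (wpaths c.+1 c.+1) (forced_factor k c.+1 t' s.+1) H) U.
  move=> hU U0; rewrite !transfer2 !big_distrr -big_split.
  rewrite big_seq [RHS]big_seq; apply: eq_bigr => -[|l L] hL;
    first by case/wpathsP: hL.
  have [lc|lc] := eqVneq l c; last first.
    rewrite /H (@forced_factor_head k c _ t) //=; first by rewrite !mulr0 addr0.
      by have [[->] _] := wpathsP _ _ _ hL.
    rewrite /post; case: (k - s.+1)%N => [|n] /=; [by left | right].
    by exists s.+2, [seq forced_factor k c.+1 t j | j <- iota s.+3 n].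
  rewrite lc in hL *; rewrite /= !mulrA -mulrDl; congr (_ * _).
  exact: path_factor_exchange.
have [s0|s0] := posnP s.
  by rewrite /pre s0 /=; move: (ex (top c.+1) (top_wpaths _) (fun=> erefl));
    rewrite s0.
apply: foldr_transfer_lin => [|U hU]; last by apply: ex => //; lia.
by rewrite /pre; case: (s) s0.
Qed.

Lemma swap_inj (T : Type) j (t : nat -> T) : injective t ->
  injective (swap j t).
Proof.
move=> ti a b; rewrite /swap.
by do !case: eqP => ?; move/ti; lia.
Qed.

(** Equal recursions and equal base cases; injectivity of t makes t_(s+2) - t_(s+1) cancellable, and
    both hypotheses survive the swap and the shift of variables. *)
Lemma network_gf_fan_gf k m t : injective t -> (forall i, t i != 0) ->
  network_gf k m t = fan_gf k m t.
Proof.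
elim: m t => [|m IH] t ti t0.
  rewrite /network_gf /fan_gf cats0.
  have -> i (f : (nat -> nat) -> R) : rows_op 0 (nseq k 1%N) t i f = f.
    by elim: k i => //= k IHk i; rewrite IHk.
  transitivity (1 : R); first by [].
  elim: (iota 0 k.+1) => [|j s IHs] /=; first by [].
  by rewrite /transfer /= big_seq1 mul1r -IHs.
rewrite -released_fan_gf_all -released_network_gf_all //.
suff H s : (s <= k)%N -> forall t, injective t -> (forall i, t i != 0) ->
    released_network_gf k m.+1 s t = released_fan_gf k m.+1 s t by apply: H.
elim: s => [|s IHs] sk {ti t0} {}t ti t0.
  by rewrite released_network_gf_base released_fan_gf_base IH // => i j /ti [].
apply: (mulfI (_ : t s.+2 - t s.+1 != 0)).
  by rewrite subr_eq0; apply/eqP => /ti; lia.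
rewrite released_network_gf_step // released_fan_gf_step // !IHs ?(ltnW sk) //;
  first exact: swap_inj.
by move=> i; rewrite /swap; case: (i == _); [|case: (i == _)]; apply: t0.
Qed.

End Fans.

(** * Sorting networks and chains *)

Local Notation cell := (nat * nat)%type.

(* The cell [(i, L)] stands for the diagonal joining the vertices labelled [i] *)
(* and [i + k + m + 1 - L].                                                    *)
Definition rowcells (m i r : nat) : seq cell :=
  [seq (i, L) | L <- rev (iota r (m.+1 - r))].
Definition rows (k m a : nat) : seq cell :=
  flatten [seq rowcells m i (maxn 1 (i - k)) | i <- iota 1 a].
Definition cells (k m : nat) : seq cell := rows k m (k + m).

Lemma rowsS k m a : rows k m a.+1 = rows k m a ++ rowcells m a.+1 (maxn 1 (a.+1
  - k)).
Proof. by rewrite /rows -[iota 1 a.+1]/(iota 1 (1 +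
  a)) addnC iotaD map_cat flatten_cat /= cats0. Qed.

Lemma mem_rows k m a i L :
  ((i, L) \in rows k m a) = [&& 0 < i <= a, 0 < L <= m & i <= L + k]%N.
Proof.
apply/flatten_mapP/idP => [[i']|h].
  rewrite mem_iota => hi /mapP[L']; rewrite mem_rev mem_iota => hL [-> ->].
  by lia.
exists i; first by rewrite mem_iota; lia.
by apply/mapP; exists L => //; rewrite mem_rev mem_iota; lia.
Qed.

Lemma rows_uniq k m a : uniq (rows k m a).
Proof.
rewrite /rows; elim: (iota 1 a) (iota_uniq 1 a) => //= i s IH /andP[hi us].
rewrite cat_uniq IH // andbT map_inj_uniq ?rev_uniq ?iota_uniq;
  last by move=> x y [].
apply/hasPn => c /flatten_mapP[i' hi' /mapP[L' _ ->]].
by apply/negP => /mapP[L _ [e _]]; rewrite -e hi' in hi.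
Qed.

(** * Expansion of the operator product over sets of cells *)

Fixpoint subs (T : Type) (s : seq T) : seq (seq T) :=
  if s is c :: s' then subs s' ++ [seq c :: r | r <- subs s'] else [:: [::]].

Lemma mem_subs (T : eqType) (s r : seq T) : uniq s ->
  (r \in subs s) = (r == [seq c <- s | c \in r]).
Proof.
elim: s r => [|c s IH] r /=; first by rewrite inE.
case/andP=> cs us; rewrite mem_cat IH //.
have notin r' : r' \in subs s -> c \notin r'.
  rewrite IH // => /eqP->; rewrite mem_filter; apply/negP => /andP[_].
  by rewrite (negbTE cs).
case: (boolP (c \in r)) => cr.
  have -> : (r == [seq x <- s | x \in r]) = false.
    apply/eqP => e; move: cr; rewrite e mem_filter => /andP[_ h].
    by rewrite h in cs.
  apply/mapP/eqP => [[r' hr' e]|e].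
    rewrite e; move: (hr'); rewrite IH // => /eqP {1}->; congr (_ :: _).
    apply: eq_in_filter => x xs; rewrite inE; case: eqP => // xc.
    by rewrite -xc xs in cs.
  exists [seq x <- s | x \in r] => //; rewrite IH //; apply/eqP.
  by apply: eq_in_filter => x xs; rewrite mem_filter xs andbT.
case: (r == _) => //=; apply/negbTE/negP => /mapP[r' _ e].
by rewrite e inE eqxx in cr.
Qed.

Lemma subs_uniq (T : eqType) (s : seq T) : uniq s -> uniq (subs s).
Proof.
elim: s => //= c s IH /andP[cs us]; rewrite cat_uniq IH //=.
rewrite map_inj_uniq ?IH // ?andbT; last by move=> a b [].
apply/hasPn => r /mapP[r' _ ->]; apply/negP; rewrite mem_subs // => /eqP e.
have : c \in c :: r' by rewrite inE eqxx.
by rewrite e mem_filter (negbTE cs) andbF.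
Qed.

(** Cells in S are the diagonals present and carry no comparator; every remaining comparator has to
    swap. *)
Fixpoint reduced (m : nat) (cs : seq cell) (S : pred cell) w : bool :=
  if cs is c :: cs' then
    if S c then reduced m cs' S w
    else (w c.2.+1 < w c.2)%N && reduced m cs' S (swap c.2 w)
  else is_identity m w.

Lemma eq_reduced m cs (S S' : pred cell) w : {in cs, S =1 S'} ->
  reduced m cs S w = reduced m cs S' w.
Proof.
elim: cs w => //= c cs IH w h.
rewrite h ?inE ?eqxx // !IH // => x xs; apply: h; by rewrite inE xs orbT.
Qed.

Section GeneratingFunction.
Variable R : idomainType.

Fixpoint cells_op (t : nat -> R) (cs : seq cell) f : (nat -> nat) -> R :=
  if cs is c :: cs' then cell_op (t c.1) c.2 (cells_op t cs' f) else f.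

Lemma cells_op_cat t cs cs' f : cells_op t (cs ++ cs') f =
  cells_op t cs (cells_op t cs' f).
Proof. by elim: cs => //= c cs ->. Qed.

Lemma cells_op_row t m i r f : cells_op t (rowcells m i r) f =
  row_op (t i) r (m.+1 - r) f.
Proof.
rewrite /rowcells; elim: (m.+1 - r)%N => [//|n IH].
rewrite -{1}addn1 iotaD rev_cat [LHS]/= IH; exact/esym/row_opS_top.
Qed.

Lemma network_gf_cells_op k m t : network_gf k m t =
  cells_op t (cells k m) (delta R m) (reversal m).
Proof.
rewrite /network_gf /cells /rows.
have -> : nseq k 1%N ++ iota 1 m = [seq maxn 1 (i - k) | i <- iota 1 (k + m)].
  rewrite iotaD map_cat; congr (_ ++ _).
    rewrite -{1}(size_iota 1 k) -(size_map (fun i => maxn 1 (i - k))).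
    apply/esym/all_pred1P/allP => x /mapP[i]; rewrite mem_iota => hi -> /=.
    by lia.
  rewrite addnC iotaDl -map_comp -[LHS]map_id; apply/eq_in_map => i.
  by rewrite mem_iota /=; lia.
suff H n i w : rows_op m [seq maxn 1 (j - k) | j <- iota i n] t i (delta R m) w
  =
    cells_op t (flatten [seq rowcells m j (maxn 1 (j - k)) | j <- iota i n])
      (delta R m) w.
  exact: H.
elim: n i w => //= n IH i w.
rewrite cells_op_cat cells_op_row; congr (row_op _ _ _ _ w).
by apply: functional_extensionality => v; rewrite IH.
Qed.

(** In each factor t_i + u_L, choosing t_i puts the cell into S, and choosing u_L demands a genuine
    swap. *)
Lemma cells_op_subs t m cs w : uniq cs ->
  cells_op t cs (delta R m) w =
  \sum_(S <- subs cs | reduced m cs (mem S) w) \prod_(c <- S) t c.1.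
Proof.
elim: cs w => [|c cs IH] w /=; first by rewrite big_mkcond big_seq1 big_nil
  /delta; case: is_identity.
case/andP=> ccs ucs.
have notin S : S \in subs cs -> c \notin S.
  rewrite mem_subs // => /eqP->; rewrite mem_filter; apply/negP => /andP[_].
  by rewrite (negbTE ccs).
rewrite big_cat big_map /= /cell_op /nil_op !IH // [LHS]addrC; congr (_ + _).
  case: ifP => hw; last first.
    rewrite big_seq_cond big1 // => S /andP[hS].
    by rewrite /= (negbTE (notin S hS)) ?hw.
  rewrite big_seq_cond [RHS]big_seq_cond; apply: eq_bigl => S.
  by case: (boolP (S \in _)) => //= /notin/negbTE->; rewrite ?hw.
rewrite big_distrr big_seq_cond [RHS]big_seq_cond; apply: eq_big => [S|S _].
  case: (boolP (S \in _)) => //= _; rewrite inE eqxx /=.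
  apply: eq_reduced => x xs /=; rewrite inE; case: eqP => // xc.
  by rewrite -xc xs in ccs.
by rewrite big_cons.
Qed.

End GeneratingFunction.

(** * Comparators, inversions and idle comparators *)

Local Open Scope nat_scope.

Definition csort L (w : nat -> nat) := if w L.+1 < w L then swap L w else w.

Fixpoint run (cs : seq cell) (S : pred cell) w : nat -> nat :=
  if cs is c :: cs' then run cs' S (if S c then w else csort c.2 w) else w.

Lemma run_cat cs cs' S w : run (cs ++ cs') S w = run cs' S (run cs S w).
Proof. by elim: cs w => //= c cs IH w. Qed.

Fixpoint num_swaps (cs : seq cell) (S : pred cell) w : nat :=
  if cs is c :: cs' then
    if S c then num_swaps cs' S w
    else if w c.2.+1 < w c.2 then (num_swaps cs' S (swap c.2 w)).+1 else
      num_swaps cs' S w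
  else 0.

Definition inv m (w : nat -> nat) : nat :=
  \sum_(p : 'I_m.+1 * 'I_m.+1) ((p.1 < p.2) && (w p.2.+1 < w p.1.+1)).

Lemma inv_swap m L w : 0 < L <= m -> w L.+1 < w L ->
  inv m w = (inv m (swap L w)).+1.
Proof.
move=> hL hw.
have La : L.-1 < m.+1 by lia.
have Lb : L < m.+1 by lia.
pose a := Ordinal La; pose b := Ordinal Lb.
have ab : a != b by rewrite -val_eqE /=; lia.
pose s (i : 'I_m.+1) := tperm a b i.
have ss : involutive s by exact: tpermK.
have swE (i : 'I_m.+1) : swap L w i.+1 = w (s i).+1.
  rewrite /s /swap; case: tpermP => [->|->|/eqP ia /eqP ib] /=.
  - by rewrite prednK ?eqxx //; lia.
  - by rewrite eqSS ifF ?prednK //; [rewrite eqxx | |]; lia.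
  - have hb : i.+1 != L.+1 by rewrite eqSS; apply: contra ib => /eqP e;
    exact/eqP/val_inj.
    rewrite (negbTE hb) ifF //; apply/negP => /eqP e; move/negP: ia; apply.
    by apply/eqP/val_inj; rewrite /= -e.
(* Reindexing pairs by the transposition matches the inversions of both words, except for the
   swapped pair itself. *)
have sp_inj : injective (fun p : 'I_m.+1 * 'I_m.+1 => (s p.1, s p.2)).
  by move=> [x y] [x' y'] [/(inv_inj ss)-> /(inv_inj ss)->].
rewrite [inv m (swap L w)]/inv (reindex_inj sp_inj) /=.
rewrite /inv (bigD1 (a, b)) //= [in RHS](bigD1 (a, b)) //=.
rewrite !swE !ss /s tpermL tpermR /=.
have -> : L.-1 < L by lia.
have -> : L < L.-1 = false by lia.
rewrite prednK; last by lia.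
rewrite hw /= add0n add1n; congr (_.+1); apply: eq_bigr => -[x y] /=.
rewrite xpair_eqE negb_and !swE !ss => xy; congr nat_of_bool.
have val_s (i : 'I_m.+1) : (s i : nat) =
    if i == L.-1 :> nat then L else if i == L :> nat then L.-1 else i.
  rewrite /s; case: tpermP => [->|->|/eqP ia /eqP ib] /=; rewrite ?eqxx //.
    by case: eqP => //; lia.
  by rewrite !ifF //; apply/negbTE; rewrite -val_eqE in ia ib.
case: (boolP ((x == b) && (y == a))) => [/andP[/eqP-> /eqP->]|nba].
  rewrite /= prednK; last by lia.
  by rewrite (_ : w L < w L.+1 = false) ?andbF //; lia.
congr (_ && _); rewrite -/(s x) -/(s y) !val_s.
move: xy nba; rewrite -!val_eqE /=; set xx := nat_of_ord x;
  set yy := nat_of_ord y.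
by do !case: eqP => ?; lia.
Qed.

Lemma inv_run m cs S w : (forall c, c \in cs -> 0 < c.2 <= m) ->
  inv m w = num_swaps cs S w + inv m (run cs S w).
Proof.
elim: cs w => //= c cs IH w hcs.
have {}IH v : inv m v = num_swaps cs S v + inv m (run cs S v).
  by apply: IH => x xs; apply: hcs; rewrite inE xs orbT.
case: ifP => _; first exact: IH.
rewrite /csort; case: ifP => hw; last exact: IH.
by rewrite (inv_swap _ hw) ?hcs ?inE ?eqxx // IH.
Qed.

Lemma inv_identity m w : is_identity m w -> inv m w = 0.
Proof.
move=> /allP hw; apply: big1 => -[x y] _ /=.
have /eqP-> : w x.+1 == x.+1 by apply: hw; rewrite mem_iota;
  have := ltn_ord x; lia.
have /eqP-> : w y.+1 == y.+1 by apply: hw; rewrite mem_iota;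
  have := ltn_ord y; lia.
by rewrite ltnS; case: (ltngtP x y).
Qed.

Lemma num_swaps_le cs S w : num_swaps cs S w <= count (predC S) cs.
Proof.
elim: cs w => //= c cs IH w; case: (S c) => /=; first exact: IH.
by rewrite add1n; case: ifP => _; rewrite ?ltnS ?(leq_trans (IH _)).
Qed.

Lemma reducedE m cs S w :
  reduced m cs S w = (num_swaps cs S w == count (predC S) cs) &&
    is_identity m (run cs S w).
Proof.
elim: cs w => [|c cs IH] w //=; rewrite /csort; case: (S c) => /=;
  first by rewrite IH.
case: ifP => _ /=; first by rewrite IH add1n eqSS.
by rewrite add1n ltn_eqF // ltnS num_swaps_le.
Qed.

(* Reduced networks have the same number of comparators, hence no proper       *)
(* subnetwork of a reduced network sorts.                                      *)
Lemma reduced_max m cs S S' w : (forall c, c \in cs -> 0 < c.2 <= m) ->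
  reduced m cs S w -> {in cs, subpred S S'} ->
    is_identity m (run cs S' w) -> {in cs, S =1 S'}.
Proof.
move=> hcs; rewrite reducedE => /andP[/eqP e1 i1] sub i2.
have e3 := inv_run S w hcs; have e4 := inv_run S' w hcs.
rewrite (inv_identity i1) in e3; rewrite (inv_identity i2) in e4.
have := num_swaps_le cs S' w; have -> : num_swaps cs S' w =
  count (predC S) cs by lia.
elim: cs sub {hcs e1 i1 i2 e3 e4} => //= c cs IH sub.
have sub' : {in cs, subpred S S'} by move=> x xs; apply: sub;
  rewrite inE xs orbT.
have le : count (predC S') cs <= count (predC S) cs.
  elim: cs sub' {IH sub} => //= x s IHs sub.
  have := sub x (mem_head _ _); have {}IHs := IHs (fun y ys => sub y
    (@mem_behead _ (x :: s) y ys)).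
  by case: (S x); case: (S' x) => //=; rewrite ?ltnS; try lia; move/(_ isT).
have hc := sub c (mem_head _ _) => h x; rewrite inE => /predU1P[->|xs].
  by move: h hc; case: (S c); case: (S' c) => //=; [move=> _ /(_ isT)|lia].
apply: (IH sub') xs; move: h hc; case: (S c); case: (S' c) => //=; lia.
Qed.

(** S enlarged by the cells whose comparators are idle: the output is unchanged and the remaining
    network is reduced as soon as it sorts. *)
Fixpoint keep (cs : seq cell) (S : pred cell) w : seq cell :=
  if cs is c :: cs' then
    if S c then c :: keep cs' S w
    else if w c.2.+1 < w c.2 then keep cs' S (swap c.2 w) else c :: keep cs' S w
  else [::].

Lemma keep_sub cs S w : {subset keep cs S w <= cs}.
Proof.
elim: cs w => //= c cs IH w x.
by do !case: ifP => _; rewrite !inE; try (case/orP=> [->//|]); move/IH->;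
  rewrite orbT.
Qed.

Lemma sub_keep cs (S : pred cell) w c : c \in cs -> S c -> c \in keep cs S w.
Proof.
elim: cs w => //= x cs IH w; rewrite inE => /predU1P[->|xs] Sc;
  first by rewrite Sc mem_head.
by do !case: ifP => _; rewrite ?inE IH ?orbT.
Qed.

Lemma reduced_keep m cs S w : uniq cs -> is_identity m (run cs S w) ->
  reduced m cs (mem (keep cs S w)) w.
Proof.
elim: cs w => //= c cs IH w /andP[ccs ucs].
have cons r v : reduced m cs (mem (c :: r)) v = reduced m cs (mem r) v.
  apply: eq_reduced => x xs; rewrite /= inE; case: eqP => // e.
  by rewrite -e xs in ccs.
have nk v : c \in keep cs S v = false.
  by apply/negP => /keep_sub; apply/negP.
rewrite /csort; case: ifP => [_|_] h.
  by rewrite inE eqxx /= cons IH.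
move: h; case: ifP => hw h; first by rewrite nk IH.
by rewrite inE eqxx /= cons IH.
Qed.

(* [lcs P a i c] is the maximal size of a chain of cells satisfying [P] in the *)
(* rows 1..i and the columns a+1..a+c.                                         *)
Fixpoint lcs (P : nat -> nat -> bool) (a i c : nat) : nat :=
  if i is i'.+1 then
    (fix lcsrow c := if c is c'.+1 then
       if P i'.+1 (a + c'.+1) then (lcs P a i' c').+1
       else maxn (lcs P a i' c'.+1) (lcsrow c') else 0) c
  else 0.

Lemma lcsSS P a i c : lcs P a i.+1 c.+1 =
  if P i.+1 (a + c.+1) then (lcs P a i c).+1
  else maxn (lcs P a i c.+1) (lcs P a i.+1 c).
Proof. by []. Qed.

Lemma lcs_lip P a i c :
  (lcs P a i c <= lcs P a i c.+1 <= (lcs P a i c).+1) /\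
  (lcs P a i c <= lcs P a i.+1 c <= (lcs P a i c).+1).
Proof.
elim: i c => [|i IH] c.
  by split=> //; elim: c => // c IHc; rewrite lcsSS; case: ifP => _;
    rewrite ?max0n.
have hI c' := (IH c').2.
have h1 c' : lcs P a i.+1 c' <= lcs P a i.+1 c'.+1 <= (lcs P a i.+1 c').+1.
  rewrite lcsSS; have := hI c'; have [+ _] := IH c'; have := hI c'.+1.
  by case: ifP => _; lia.
split=> //; elim: c => [//|c IHc]; rewrite [lcs _ _ i.+2 _]lcsSS.
by have := h1 c; have := hI c; case: ifP => _; lia.
Qed.

Lemma lcs_le P a i c : lcs P a i c <= i.
Proof. by elim: i => // i IH; have [_] := lcs_lip P a i c; lia. Qed.

(** * Zero-one principle: counting small values *)

Definition count_le q (w : nat -> nat) x := count (fun y => w y <= q) (iota 1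
  x).

Lemma count_leS q w x : count_le q w x.+1 = count_le q w x + (w x.+1 <= q).
Proof. by rewrite /count_le -[x.+1]addn1 iotaD count_cat /= addn0 add1n addn1.
  Qed.

Lemma count_le0 q w : count_le q w 0 = 0. Proof. by []. Qed.

Lemma count_le_csort_lt q L w x : x < L ->
  count_le q (csort L w) x = count_le q w x.
Proof.
move=> xL; rewrite /csort; case: ifP => // _; apply: eq_in_count => y.
by rewrite mem_iota => hy; rewrite swap_out //; lia.
Qed.

Lemma count_le_csort_out q L w x : 0 < L -> x != L ->
  count_le q (csort L w) x = count_le q w x.
Proof.
case: L => // L _; case: (ltngtP x L.+1) => // [/count_le_csort_lt->//|].
elim: x => // x IH; rewrite ltnS leq_eqVlt => /predU1P[<-|xL] _; last first.
  by rewrite count_leS IH ?gtn_eqF // count_leS /csort; case: ifP => // _;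
    rewrite swap_out //; lia.
rewrite !count_leS count_le_csort_lt // /csort; case: ifP => // _.
by rewrite swapjj swapjS -!addnA [X in _ + X]addnC.
Qed.

(** This minimum is the chain recursion in disguise: subtracted from the row number, it becomes the
    maximum in [lcsSS]. *)
Lemma count_le_csort q L w : 0 < L ->
  count_le q (csort L w) L = minn (count_le q w L.-1).+1 (count_le q w L.+1).
Proof.
case: L => // L _; rewrite !count_leS count_le_csort_lt //= /csort.
by case: ifP => h; rewrite ?swapjj; case: leqP; case: leqP => *; lia.
Qed.

Lemma lcs_lec P a i c : lcs P a i c <= c.
Proof.
elim: c => [|c IH]; first by case: i.
by have [] := lcs_lip P a i c; lia.
Qed.

Lemma lcs_diag (P : nat -> nat -> bool) a s u d :
  (forall e, 0 < e <= d -> P (s + e) (a + (u + e))) ->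
    d <= lcs P a (s + d) (u + d).
Proof.
elim: d => // d IH hP; rewrite !addnS lcsSS -!addnS hP; last by lia.
by rewrite ltnS IH // => e he; apply: hP; lia.
Qed.

Section Threshold.
Variables (k m q : nat) (S : pred cell).
Hypothesis hq : 0 < q <= m.

(** Pairs at trivial distance count as present, whatever S is; they fill up the borders of the chain
    recursion. *)
Definition chord (i j : nat) : bool :=
  (k < j - i < k + m.+1) ==> S (i, i + (k + m.+1) - j).

Let p := m.+1 - q.
Let ell := lcs chord (k + q).

(** The invariant of the zero-one principle: after row i, the values at most q among the first x
    positions number i minus a longest chain. In the second range the count is still that of the
    reversed word. *)
Definition tracks i w x :=
  (x <= i + p -> count_le q w x + ell i (i + p - x) = i) /\
  (i + p <= x -> count_le q w x = x - p).

Lemma tracks_step i w L : 0 < L <= m -> tracks i w L.-1 -> tracks i w L ->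
  tracks i.+1 w L.+1 ->
  tracks i.+1 (if S (i.+1, L) then w else csort L w) L.
Proof.
move=> hL [m1 m2] [z1 z2] [p1 p2].
set w' := if _ then _ else _.
have zE : count_le q w' L = if S (i.+1, L) then count_le q w L
    else minn (count_le q w L.-1).+1 (count_le q w L.+1).
  by rewrite /w'; case: ifP => // _; rewrite count_le_csort //; lia.
case: (leqP (i.+1 + p) L) => h.
  have e : count_le q w' L = L - p.
    by rewrite zE z2 ?m2 ?p2; try lia; case: ifP => _; lia.
  split=> h'; rewrite e; last by [].
  have -> : i.+1 + p - L = 0 by lia.
  by rewrite /ell /=; lia.
split=> h'; last by lia.
have e : i.+1 + p - L = (i + p - L).+1 by lia.
rewrite e zE /ell lcsSS /chord.
have -> : k + q + (i + p - L).+1 = i.+1 + (k + m.+1) - L by lia.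
have -> : (k < i.+1 + (k + m.+1) - L - i.+1 < k + m.+1) = true by lia.
have -> : i.+1 + (k + m.+1) - (i.+1 + (k + m.+1) - L) = L by lia.
rewrite implyTb.
have z1' := z1 ltac:(lia); have m1' := m1 ltac:(lia); have p1' := p1 ltac:(lia).
move: z1' m1' p1'; have -> : i + p - L.-1 = (i + p - L).+1 by lia.
have -> : i.+1 + p - L.+1 = i + p - L by lia.
rewrite -/ell; case: ifP => _; lia.
Qed.

Lemma tracks_ext i w w' x : count_le q w x = count_le q w' x ->
  tracks i w x -> tracks i w' x.
Proof. by rewrite /tracks => ->. Qed.

(** A row runs downwards, so at position L the entry L+1 already tracks row i+1 while L-1 and L
    still track row i: just the data that the chain recursion needs. *)
Lemma tracks_row i w : count_le q w m.+1 = q ->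
  (forall x, i - k <= x <= m.+1 -> tracks i w x) ->
  forall n L, L + n = m.+1 -> maxn 1 (i.+1 - k) <= L ->
  let wL := run [seq (i.+1, y) | y <- rev (iota L n)] S w in
  count_le q wL m.+1 = q /\
  (forall x, i - k <= x < L -> tracks i wL x) /\
  (forall x, L <= x <= m.+1 -> tracks i.+1 wL x).
Proof.
move=> tot hw; elim=> [|n IH] L hL lL /=.
  split=> //; split=> x hx; first by apply: hw; lia.
  have -> : x = m.+1 by lia.
  split=> h; rewrite tot; last by lia.
  have e1 : i.+1 + p - m.+1 = i.+1 - q by lia.
  have lc := lcs_lec chord (k + q) i.+1 (i.+1 - q).
  (* At the right border the chain consists of pairs at distance k, which are trivial. *)
  have : i.+1 - q <= lcs chord (k + q) (q + (i.+1 - q)) (0 + (i.+1 - q)).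
    apply: lcs_diag => e he; rewrite /chord.
    have e2 : k + q + (0 + e) - (q + e) = k by lia.
    by rewrite e2 ltnn.
  rewrite add0n subnKC; last by lia.
  by rewrite e1 /ell; lia.
have [t0 [IH1 IH2]] := IH L.+1 ltac:(lia) ltac:(lia).
rewrite rev_cons map_rcons -cats1 run_cat /=.
set v := run _ S w in t0 IH1 IH2 *.
have out x : x != L -> count_le q (if S (i.+1,
  L) then v else csort L v) x = count_le q v x.
  by move=> xL; case: ifP => // _; rewrite count_le_csort_out //; lia.
split; first by rewrite out //; lia.
split=> x hx; first by apply: (@tracks_ext i v); [rewrite out //;
  lia | apply: IH1; lia].
have [->|xL] := eqVneq x L; last first.
  by apply: (@tracks_ext i.+1 v); [rewrite out | apply: IH2; lia].
by apply: tracks_step; [lia | apply: IH1; lia | apply: IH1; lia | apply: IH2;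
  lia].
Qed.

Lemma tracks_rows i : i <= k + m ->
  let w := run (rows k m i) S (reversal m) in
  count_le q w m.+1 = q /\ forall x, i - k <= x <= m.+1 -> tracks i w x.
Proof.
elim: i => [|i IH] hi.
  have zw x : x <= m.+1 -> count_le q (reversal m) x = x - p.
    elim: x => // x IHx hx; rewrite count_leS IHx; last by lia.
    by rewrite /reversal; case: leqP; lia.
  split=> [|x hx]; first by rewrite zw //; lia.
  by split=> h; rewrite zw /ell /=; lia.
have [tot hw] := IH ltac:(lia).
rewrite rowsS run_cat /rowcells; set w := run (rows k m i) S _ in tot hw *.
have [] := tracks_row tot hw (n := m.+1 - maxn 1 (i.+1 - k)) (L := maxn 1 (i.+1
  - k))
  ltac:(lia) ltac:(lia).
set v := run _ S w => t [_ hv]; split=> // x hx.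
case: (leqP (maxn 1 (i.+1 - k)) x) => hx'; first by apply: hv; lia.
have -> : x = 0 by lia.
split=> h; last by rewrite count_le0; lia.
(* At the left border the pairs have distance k+m+1, trivial around the other side of the
   polygon. *)
rewrite count_le0 add0n subn0; apply/eqP; rewrite eqn_leq lcs_le addnC.
apply: (@lcs_diag chord (k + q) 0 p i.+1) => e he.
have out : (k + q + (p + e) - (0 + e) < k + m.+1) = false by lia.
by rewrite /chord out andbF.
Qed.

(** After row k+q, every row stops above position q, so the count there is already final. *)
Lemma count_le_rows i : k + q <= i <= k + m ->
  count_le q (run (rows k m i) S (reversal m)) q + ell (k + q) (k + p) = k + q.
Proof.
elim: i => [|i IH] hi; first by lia.
have [e|ne] := eqVneq i.+1 (k + q).
  have hi' : i.+1 <= k + m by lia.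
  have [_ t] := tracks_rows hi'; have [+ _] := t q ltac:(lia).
  by rewrite e -addnA [q + p]addnC addnA addnK; apply; lia.
have {}IH := IH ltac:(lia); rewrite -[RHS]IH; congr (_ + _).
rewrite rowsS run_cat /rowcells; set w := run _ S (reversal m).
have : all (fun y => q < y) (rev (iota (maxn 1 (i.+1 - k)) (m.+1 - maxn 1 (i.+1
  - k)))).
  by apply/allP => y; rewrite mem_rev mem_iota; lia.
elim: (rev _) w => //= y s IHs w /andP[qy hs]; rewrite IHs //.
by case: ifP => // _; rewrite count_le_csort_out //; lia.
Qed.

End Threshold.

Lemma identity_count_le m w : (forall q, q <= m.+1 -> count_le q w m.+1 = q) ->
  is_identity m w <-> (forall q, 0 < q <= m -> count_le q w q = q).
Proof.
move=> tot; split=> [/allP hw q hq|hz].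
  apply/eqP; rewrite -[X in _ == X](size_iota 1 q) -all_count;
    apply/allP => y; rewrite mem_iota => hy.
  have /eqP-> : w y == y by apply: hw; rewrite mem_iota; lia.
  lia.
have hz' q : q <= m.+1 -> count_le q w q = q.
  case: q => // q hq; case: (ltnP q m) => qm; first by apply: hz; lia.
  by rewrite (_ : q = m); [apply: tot | lia].
apply/allP => x; rewrite mem_iota => hx.
have le : w x <= x.
  have : all (fun y => w y <= x) (iota 1 x).
    by rewrite all_count size_iota -/(count_le x w x) hz' //; lia.
  by move/allP; apply; rewrite mem_iota; lia.
have e : count_le x.-1 w m.+1 = count_le x.-1 w x.-1 by rewrite tot ?hz' //;
  lia.
move: e; rewrite /count_le (_ : m.+1 = x.-1 + (m.+1 - x.-1)); last by lia.
rewrite iotaD count_cat -[RHS]addn0 => /addnI/eqP;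
  rewrite -leqn0 leqNgt -has_count.
move/hasPn => /(_ x); rewrite mem_iota => h.
by have := h ltac:(lia); lia.
Qed.

Lemma count_le_run m q cs S w : (forall c, c \in cs -> 0 < c.2 <= m) ->
  count_le q (run cs S w) m.+1 = count_le q w m.+1.
Proof.
elim: cs w => //= c cs IH w h; rewrite IH; last by move=> x xs; apply: h;
  rewrite inE xs orbT.
have := h c (mem_head _ _); case: ifP => // _ hc.
by rewrite count_le_csort_out //; lia.
Qed.

Lemma cells_letter k m c : c \in cells k m -> 0 < c.2 <= m.
Proof. by case: c => i L; rewrite mem_rows /=; lia. Qed.

(** The word is sorted iff each threshold q is, that is, iff its first q positions hold q small
    values; by [count_le_rows] this bounds the longest chain across the cut after vertex k+q. *)
Lemma sorts_lcs k m S :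
  is_identity m (run (cells k m) S (reversal m)) <->
  (forall q, 0 < q <= m ->
     lcs (chord k m S) (k + q) (k + q) (k + (m.+1 - q)) <= k).
Proof.
have totw q : q <= m.+1 -> count_le q (reversal m) m.+1 = q.
  have H x : x <= m.+1 -> count_le q (reversal m) x = x - (m.+1 - q).
    elim: x => // x IHx hx; rewrite count_leS IHx; last by lia.
    by rewrite /reversal; case: leqP; lia.
  by move=> hq; rewrite H //; lia.
have tot q : q <= m.+1 -> count_le q (run (cells k m) S (reversal m)) m.+1 = q.
  by move=> hq; rewrite count_le_run ?totw //; apply: cells_letter.
rewrite (identity_count_le tot).
have zr q (hq : 0 < q <= m) := @count_le_rows k m q S hq (k + m) ltac:(lia).
have zq q : count_le q (run (cells k m) S (reversal m)) q <= q.
  by rewrite -{3}(size_iota 1 q); apply: count_size.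
by split=> h q hq; have := h q hq; have := zr q hq; have := zq q;
   rewrite /cells; lia.
Qed.

(** * Triangulations as reduced networks *)

Arguments lcs : simpl never.

Section Triangulations.
Variables (k m n : nat).
Hypotheses (hk : 0 < k) (hn : n = (2 * k + m).+1).
Implicit Types (X Y S : {set 'I_n * 'I_n}) (p : 'I_n * 'I_n).

Local Notation r1 p := (nat_of_ord (@fst 'I_n 'I_n p)).
Local Notation r2 p := (nat_of_ord (@snd 'I_n 'I_n p)).

Lemma crossingP X p q : mutually_crossing X -> p \in X -> q \in X -> p != q ->
  (r1 p < r1 q /\ r1 q < r2 p /\ r2 p < r2 q) \/ (r1 q < r1 p /\ r1 p < r2 q /\
    r2 q < r2 p).
Proof.
move=> /forall_inP/(_ p) h pX; move/(_ pX)/forall_inP: h => h qX pq.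
by move/(_ q qX)/implyP/(_ pq): h => /orP[/and3P[]|/and3P[]]; [left|right].
Qed.

Lemma mutually_crossingS X Y : Y \subset X -> mutually_crossing X ->
  mutually_crossing Y.
Proof.
move=> /subsetP YX /forall_inP h; apply/forall_inP => p /YX /h /forall_inP h'.
by apply/forall_inP => q /YX /h'.
Qed.

(** Mutually crossing diagonals over a common cut increase strictly in both ends, so they form a
    chain; the recursion is followed according to whether the last row or corner is used. *)
Lemma lcs_bound (P : nat -> nat -> bool) a i c X : i <= a ->
  mutually_crossing X ->
  {in X, forall p, [/\ P (r1 p).+1 (r2 p).+1, (r1 p).+1 <= i,
    a < (r2 p).+1 & (r2 p).+1 <= a + c]} ->
  #|X| <= lcs P a i c.
Proof.
elim: i c X => [|i IHi] c X ia mX hX.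
  rewrite leqNgt; apply/negP => /card_gt0P[p /hX[]]; lia.
elim: c X mX hX => [|c IHc] X mX hX.
  rewrite leqNgt; apply/negP => /card_gt0P[p /hX[]]; lia.
have [l1 l2] := lcs_lip P a i c; have [l3 l4] := lcs_lip P a i c.+1.
have [l5 l6] := lcs_lip P a i.+1 c.
case: (pickP [pred p in X | (p.1.+1 == i.+1) && (p.2.+1 == a +
  c.+1)]) => [p|no] /=.
  case/and3P=> pX /eqP p1 /eqP p2; have [Pp _ _ _] := hX p pX.
  rewrite (cardsD1 p) pX lcsSS -p1 -p2 Pp add1n ltnS; apply: IHi; first by lia.
    by apply: mutually_crossingS mX; apply: subD1set.
  move=> q; rewrite !inE => /andP[qp qX]; have [Pq q1 q2 q3] := hX q qX.
  have e1 : r1 p = i :> nat by case: p1.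
  have e2 : (r2 p).+1 = a + c.+1 :> nat by [].
  by have cr := crossingP mX qX pX qp; split=> //; lia.
case: (pickP [pred p in X | p.1.+1 == i.+1]) => [p|no1] /=.
  case/andP=> pX /eqP p1; case/andP: l5 => l5 _; apply: leq_trans l5.
  apply: IHc => //.
  move=> q qX; have [Pq q1 q2 q3] := hX q qX; split=> //.
  have np : (r2 p).+1 <> a + c.+1 :> nat.
    by move=> e; have := no p; rewrite /= pX p1 e !eqxx.
  have e1 : r1 p = i :> nat by case: p1.
  have [_ _ _ p3] := hX p pX; have [->|qp] := eqVneq q p; first by lia.
  by have := crossingP mX qX pX qp; lia.
case/andP: l4 => l4 _; apply: leq_trans l4.
apply: IHi => //; first by lia.
move=> q qX; have [Pq q1 q2 q3] := hX q qX; split=> //.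
have n1 : (r1 q).+1 <> i.+1 :> nat by move=> e; have := no1 q;
  rewrite /= qX e eqxx.
by lia.
Qed.

Lemma lcs_exists (P : nat -> nat -> bool) a i c d : i <= a -> a + c <= n ->
  d <= lcs P a i c -> exists X, [/\ #|X| = d, mutually_crossing X &
  {in X, forall p, [/\ P (r1 p).+1 (r2 p).+1, (r1 p).+1 <= i,
    a < (r2 p).+1 & (r2 p).+1 <= a + c]}].
Proof.
have e0 : exists X, [/\ #|X| = 0, mutually_crossing X & forall Q : 'I_n *
  'I_n -> Prop,
    {in X, forall p, Q p}].
  exists set0; rewrite cards0; split=> //; last by move=> Q p; rewrite inE.
  by apply/forall_inP => p; rewrite inE.
elim: i c d => [|i IHi] c d ia.
  rewrite leqn0 => _ /eqP->; have [X [h1 h2 h3]] := e0; exists X; split=> //;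
    exact: h3.
elim: c d => [|c IHc] d hc.
  rewrite leqn0 => /eqP->; have [X [h1 h2 h3]] := e0; exists X; split=> //;
    exact: h3.
rewrite lcsSS; case: ifP => [Pic|_].
  case: d => [_|d].
    by have [X [h1 h2 h3]] := e0; exists X; split=> //; exact: h3.
  rewrite ltnS => hd.
  have [X [X1 X2 X3]] := IHi c d ltac:(lia) ltac:(lia) hd.
  have li : i < n by lia.
  have lj : a + c < n by lia.
  pose p := (Ordinal li, Ordinal lj).
  have pX : p \notin X by apply/negP => /X3[]; rewrite /=; lia.
  have cr q : q \in X -> crossing q p.
    by move=> /X3[_ h1 h2 h3]; rewrite /crossing /=; lia.
  exists (p |: X); split.
  - by rewrite cardsU1 pX X1.
  - apply/forall_inP => q qX; apply/forall_inP => r rX; apply/implyP => qr.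
    move: qX rX; rewrite !inE => /predU1P[eq|qX] /predU1P[er|rX].
    + by rewrite eq er eqxx in qr.
    + by rewrite eq /crossing orbC; exact: cr.
    + by rewrite er; exact: cr.
    + by move/forall_inP/(_ q qX)/forall_inP/(_ r rX)/implyP/(_ qr): X2.
  - move=> q; rewrite !inE => /predU1P[->|/X3[h1 h2 h3 h4]];
    last by split=> //; lia.
    by split=> //=; [rewrite addnS in Pic | lia | lia].
rewrite leq_max => /orP[hd|hd].
  have [X [X1 X2 X3]] := IHi c.+1 d ltac:(lia) hc hd.
  by exists X; split=> // q /X3[h1 h2 h3 h4]; split=> //; lia.
have [X [X1 X2 X3]] := IHc d ltac:(lia) hd.
by exists X; split=> // q /X3[h1 h2 h3 h4]; split=> //; lia.
Qed.

Lemma card_interval lo hi : #|[set v : 'I_n | lo < v.+1 <= hi]| <= hi - lo.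
Proof.
rewrite cardE -(size_map (@nat_of_ord n)) -[X in _ <= X](size_iota lo);
  apply: uniq_leq_size.
  by rewrite map_inj_uniq ?enum_uniq //; exact: val_inj.
by move=> x /mapP[v]; rewrite mem_enum inE mem_iota => hv ->; lia.
Qed.

Lemma chain_interval X (f : 'I_n * 'I_n -> 'I_n) lo hi :
  {in X &, injective f} -> {in X, forall p, lo < (f p).+1 <= hi} ->
    #|X| <= hi - lo.
Proof.
move=> fi hf; rewrite -(card_in_imset fi);
  apply: leq_trans (card_interval lo hi).
by apply/subset_leq_card/subsetP => v /imsetP[p pX ->]; rewrite inE hf.
Qed.

Lemma crossing_inj X : mutually_crossing X ->
  {in X &, injective fst} /\ {in X &, injective snd}.
Proof.
move=> mX; split=> p q pX qX e; apply/eqP; apply: contraT => pq.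
  have e1 : r1 p = r1 q := congr1 (@nat_of_ord n) e.
  by have := crossingP mX pX qX pq; lia.
have e2 : r2 p = r2 q := congr1 (@nat_of_ord n) e.
by have := crossingP mX pX qX pq; lia.
Qed.

Definition cellof p : nat * nat := ((r1 p).+1,
  (r1 p).+1 + (k + m.+1) - (r2 p).+1).
Definition cellset S : pred (nat * nat) := fun c => [exists p in S,
  cellof p == c].

Lemma chordE S p : k < r2 p - r1 p < k + m.+1 ->
  chord k m (cellset S) (r1 p).+1 (r2 p).+1 = (p \in S).
Proof.
case: p => a b /= hp; rewrite /chord subSS hp /=.
apply/exists_inP/idP => [[[c d] cdS /eqP[e1 e2]]|pS]; last by exists (a, b).
have ea : a = c :> nat by rewrite e1.
have -> : a = c by apply: val_inj.
by have -> : b = d by apply: val_inj => /=; lia.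
Qed.

(** Chains across a cut are mutually crossing sets, and conversely every mutually crossing set has a
    common cut. The padding by trivial pairs is harmless, since these lie in no (k+1)-crossing. *)
Lemma no_big_crossingP S : reflect
  ({in S, forall p, is_diagonal p} /\
   is_identity m (run (cells k m) (cellset S) (reversal m)))
  (no_big_crossing k S).
Proof.
apply: (iffP andP) => [[/forall_inP dS /forallP hS]|[dS hS]].
  split=> //; apply/sorts_lcs => q hq; rewrite leqNgt; apply/negP => big.
  have hc : k + q + (k + (m.+1 - q)) <= n by lia.
  have [X [X1 X2 X3]] := lcs_exists (leqnn (k + q)) hc big.
  have [i1 i2] := crossing_inj X2.
  have := hS X; rewrite X1 eqxx andbT X2 implybF => /negP; apply.
  apply/subsetP => p pX; have [Pp p1 p2 p3] := X3 p pX.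
  (* The k diagonals crossing p have pairwise distinct ends, one on each side of p. Counting these
     ends leaves more than k vertex steps on both sides, so p is nontrivial. *)
  pose Lo := [set r in X | r1 r < r1 p]; pose Hi := [set r in X | r1 p < r1 r].
  have card : #|Lo| + #|Hi| = k.
    have := cardsD1 p X; rewrite pX X1 add1n => -[ck]; rewrite [RHS]ck -cardsUI.
    have -> : Lo :&: Hi = set0 by apply/setP => r; rewrite !inE; case: ltngtP;
      rewrite ?andbF.
    rewrite cards0 addn0; apply: eq_card => r.
    rewrite !inE; case: (boolP (r \in X)) => rX; rewrite ?andbF //=.
    have [->|rp] := eqVneq r p; first by rewrite ltnn.
    by have := crossingP X2 rX pX rp; lia.
  have sLo : {subset Lo <= X} by move=> r; rewrite inE => /andP[].
  have sHi : {subset Hi <= X} by move=> r; rewrite inE => /andP[].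
  have b1 : #|Lo| <= r1 p - 0.
    apply: (@chain_interval _ fst); first exact: sub_in2 i1.
    by move=> r; rewrite inE => /andP[].
  have b2 : #|Lo| <= r2 p - (k + q).
    apply: (@chain_interval _ snd); first exact: sub_in2 i2.
    move=> r; rewrite inE => /andP[rX rp]; have [_ _ -> _] := X3 r rX.
    have ne : r != p by apply: contraTneq rp => ->; rewrite ltnn.
    by have := crossingP X2 rX pX ne; lia.
  have b3 : #|Hi| <= (k + q) - (r1 p).+1.
    apply: (@chain_interval _ fst); first exact: sub_in2 i1.
    by move=> r; rewrite inE => /andP[rX rp]; have [_ ? _ _] := X3 r rX; lia.
  have b4 : #|Hi| <= n - (r2 p).+1.
    apply: (@chain_interval _ snd); first exact: sub_in2 i2.
    move=> r; rewrite inE => /andP[rX rp].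
    have ne : r != p by apply: contraTneq rp => ->; rewrite ltnn.
    by have := crossingP X2 rX pX ne; have := ltn_ord (@snd 'I_n 'I_n r); lia.
  by rewrite -chordE //; have := ltn_ord (@snd 'I_n 'I_n p); lia.
split; first exact/forall_inP.
apply/forallP => X; apply/implyP => /andP[/subsetP XS /eqP X1];
  apply/negP => mX.
have : 0 < #|X| by rewrite X1.
case/card_gt0P => p0 p0X.
(* Cutting right after the largest first endpoint separates the two ends of every member of X. *)
pose p := [arg max_(r > p0 in X) r1 r].
have [pX pmax] : p \in X /\ forall r, r \in X -> r1 r <= r1 p.
  by rewrite /p; case: arg_maxnP.
have rX r : r \in X -> (r1 r).+1 <= (r1 p).+1 /\ (r1 p).+1 < (r2 r).+1.
  move=> hr; split; first by rewrite ltnS pmax.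
  have [e|ne] := eqVneq r p; first by have := dS _ (XS _ hr);
    rewrite e /is_diagonal; lia.
  by have := crossingP mX hr pX ne; have := pmax _ hr; lia.
have bound (P : nat -> nat -> bool) : {in X, forall r, P (r1 r).+1 (r2 r).+1} ->
    k.+1 <= lcs P (r1 p).+1 (r1 p).+1 (n - (r1 p).+1).
  move=> hP; rewrite -X1; apply: lcs_bound => // r hr; have [? ?] := rX r hr.
  by split=> //; [exact: hP | have := ltn_ord (@snd 'I_n 'I_n r); lia].
(* With the constantly true predicate this bounds k+1 by the rows and by the columns at this cut, so
   q = r1 p + 1 - k is an admissible threshold. *)
have t := bound (fun _ _ => true) (fun _ _ => isT).
have := lcs_le (fun _ _ => true) (r1 p).+1 (r1 p).+1 (n - (r1 p).+1).
have := lcs_lec (fun _ _ => true) (r1 p).+1 (r1 p).+1 (n - (r1 p).+1) => t1 t2.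
have hq : 0 < (r1 p).+1 - k <= m by lia.
move/sorts_lcs/(_ ((r1 p).+1 - k) hq): hS.
have -> : k + ((r1 p).+1 - k) = (r1 p).+1 by lia.
have -> : k + (m.+1 - ((r1 p).+1 - k)) = n - (r1 p).+1 by lia.
rewrite leqNgt bound // => r hr.
rewrite /chord subSS; apply/implyP => hd.
by move: (chordE S hd); rewrite /chord subSS hd /= => ->; apply: XS.
Qed.

Lemma polygon_distE p : r1 p < r2 p ->
  polygon_dist p.1 p.2 = minn (r2 p - r1 p) (n - (r2 p - r1 p)).
Proof.
move=> h; rewrite /polygon_dist; have -> : p.1 - p.2 = 0 by lia.
by rewrite add0n.
Qed.

Lemma cellof_inj p q : cellof p \in cells k m -> cellof p = cellof q -> p = q.
Proof.
case: p q => [a b] [c d]; rewrite /cellof mem_rows /= => h [e1 e2].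
have -> : a = c by apply: val_inj.
by have -> : b = d by apply: val_inj => /=; lia.
Qed.

Lemma cellsetE S p : cellof p \in cells k m -> cellset S (cellof p) = (p \in S).
Proof.
move=> pc; apply/exists_inP/idP => [[q qS /eqP e]|pS]; last by exists p.
by rewrite (cellof_inj pc (esym e)).
Qed.

Lemma cellof_cells p : (cellof p \in cells k m) = (k < r2 p - r1 p < k + m.+1).
Proof.
rewrite mem_rows /=; have := ltn_ord (@fst 'I_n 'I_n p).
by have := ltn_ord (@snd 'I_n 'I_n p); lia.
Qed.

Lemma nontrivialE p : is_diagonal p ->
  (k < polygon_dist p.1 p.2) = (cellof p \in cells k m).
Proof.
rewrite /is_diagonal cellof_cells => /andP[h _].
by rewrite polygon_distE //; have := ltn_ord (@snd 'I_n 'I_n p); lia.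
Qed.

Lemma cells_diagonal p : cellof p \in cells k m -> is_diagonal p.
Proof.
rewrite /is_diagonal cellof_cells => h; have l : r1 p < r2 p by lia.
by rewrite polygon_distE // l; have := ltn_ord (@snd 'I_n 'I_n p); lia.
Qed.

Lemma cells_cellof c : c \in cells k m -> exists p, cellof p = c.
Proof.
case: c => i L; rewrite mem_rows => h.
have li : i.-1 < n by lia.
have lj : (i + (k + m.+1) - L).-1 < n by lia.
by exists (Ordinal li, Ordinal lj); rewrite /cellof /=; congr pair; lia.
Qed.

(** All trivial diagonals are included, since a maximal set contains them. *)
Definition diagonals_of (s : seq (nat * nat)) : {set 'I_n * 'I_n} :=
  [set p | is_diagonal p && ((polygon_dist p.1 p.2 <= k) || (cellof p \in s))].
Definition network_of S : seq (nat * nat) := [seq c <- cells k m | cellset S c].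

Lemma cellset_diagonals_of s : {in cells k m,
  cellset (diagonals_of s) =1 mem s}.
Proof.
move=> c cc; have [p ep] := cells_cellof cc; rewrite -ep in cc *.
rewrite cellsetE // inE cells_diagonal // leqNgt nontrivialE ?cc //.
exact: cells_diagonal.
Qed.

Lemma eq_run cs (S S' : pred (nat * nat)) w :
  {in cs, S =1 S'} -> run cs S w = run cs S' w.
Proof.
elim: cs w => //= c cs IH w h.
by rewrite h ?inE ?eqxx // IH // => x xs; apply: h; rewrite inE xs orbT.
Qed.

Lemma no_big_diagonals_of s : is_identity m (run (cells k m) (mem s) (reversal
  m)) ->
  no_big_crossing k (diagonals_of s).
Proof.
move=> h; apply/no_big_crossingP; split; first by move=> p;
  rewrite inE => /andP[].
by rewrite (eq_run _ (@cellset_diagonals_of s)).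
Qed.

Lemma reduced_run cs (S : pred (nat * nat)) w : reduced m cs S w ->
  is_identity m (run cs S w).
Proof. by rewrite reducedE => /andP[]. Qed.

(** Adding the trivial diagonals and the idle cells to S creates no (k+1)-crossing, so by maximality
    nothing new was added. *)
Lemma ktriangulation_reduced S : ktriangulation k S ->
  diagonals_of (network_of S) = S /\ reduced m (cells k m) (mem (network_of S))
    (reversal m).
Proof.
case/maxsetP=> /no_big_crossingP[dS iS] maxS.
pose s := keep (cells k m) (cellset S) (reversal m).
have vs : reduced m (cells k m) (mem s) (reversal m) by apply: reduced_keep =>
  //; exact: rows_uniq.
have SE : diagonals_of s = S.
  apply: maxS; first exact/no_big_diagonals_of/reduced_run.
  apply/subsetP => p pS; rewrite inE dS //= leqNgt nontrivialE ?dS //.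
  case: (boolP (cellof p \in cells k m)) => //= pc.
  by apply: sub_keep; rewrite ?cellsetE.
have sE : {in cells k m, mem (network_of S) =1 mem s}.
  by move=> c cc; rewrite /= mem_filter cc andbT -{1}SE cellset_diagonals_of.
split; last by rewrite (eq_reduced _ _ sE).
rewrite -[RHS]SE; apply/setP => p; rewrite !inE;
  case: (boolP (is_diagonal p)) => //= dp.
rewrite leqNgt nontrivialE //; case: (boolP (cellof p \in cells k m)) => //= pc.
exact: sE.
Qed.

(** A larger set without (k+1)-crossing would give a sorting network with fewer comparators than the
    swaps required. *)
Lemma reduced_ktriangulation s : s \in subs (cells k m) ->
  reduced m (cells k m) (mem s) (reversal m) ->
  ktriangulation k (diagonals_of s) /\ network_of (diagonals_of s) = s.
Proof.
rewrite mem_subs ?rows_uniq // => /eqP es vs; split; last first.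
  by rewrite {2}es; apply: eq_in_filter => c cc; rewrite cellset_diagonals_of.
apply/maxsetP; split; first exact/no_big_diagonals_of/reduced_run.
move=> S' /no_big_crossingP[dS' iS'] sS'.
have eS : {in cells k m, mem s =1 cellset S'}.
  apply: (reduced_max (@cells_letter k m) vs) iS' => c cc /= cs.
  have [p ep] := cells_cellof cc; rewrite -ep in cc cs *.
  by rewrite cellsetE // (subsetP sS') // inE cells_diagonal // cs orbT.
apply/eqP; rewrite eqEsubset sS' andbT; apply/subsetP => p pS'.
rewrite inE dS' //= leqNgt nontrivialE ?dS' //.
case: (boolP (_ \in cells k m)) => //= pc.
by rewrite -[_ \in s]/(mem s (cellof p)) eS // cellsetE.
Qed.

Lemma perm_network_of :
  perm_eq [seq network_of (val T) | T : {S : {set 'I_n *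
    'I_n} | ktriangulation k S}]
          [seq s <- subs (cells k m) | reduced m (cells k m) (mem s) (reversal
            m)].
Proof.
apply: uniq_perm.
- rewrite map_inj_in_uniq ?enum_uniq // => -[S hS] [S' hS'] _ _ /= e.
  apply: val_inj => /=; rewrite -(ktriangulation_reduced hS).1 e.
  exact: (ktriangulation_reduced hS').1.
- by rewrite filter_uniq // subs_uniq // rows_uniq.
move=> s; rewrite mem_filter; apply/mapP/andP => [[[S hS] _ ->]|[vs ss]].
  have [_ v] := ktriangulation_reduced hS; split=> //=.
  rewrite mem_subs ?rows_uniq //; apply/eqP; rewrite {1}/network_of;
    apply: eq_in_filter.
  by move=> c cc; rewrite mem_filter cc andbT.
have [h e] := reduced_ktriangulation ss vs.
by exists (Sub (diagonals_of s) h); rewrite ?mem_enum //= e.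
Qed.

Lemma degree_network_of S (v : 'I_n) : ktriangulation k S ->
  degree k S v = count (fun c => c.1 == v.+1) (network_of S).
Proof.
case/maxsetP=> /no_big_crossingP[dS _] _.
rewrite -size_filter /degree cardE -(size_map (fun w => cellof (v, w))).
have dist p : p \in S -> r1 p < r2 p by move/dS/andP=> [].
apply/perm_size/uniq_perm.
- rewrite map_inj_in_uniq ?enum_uniq // => w w';
  rewrite mem_enum inE => /andP[lw].
  case/andP=> /orP[] hS kd _ e; last by have := dist _ hS; move: lw;
    rewrite /label /=; lia.
  suff [//] : (v, w) = (v, w').
  by apply: cellof_inj e; rewrite -nontrivialE //; exact: dS.
- by rewrite !filter_uniq // rows_uniq.
move=> c; rewrite !mem_filter; apply/mapP/and3P => [[w]|[/eqP c1 /exists_inP[p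
  pS /eqP e] cc]].
  rewrite mem_enum inE => /andP[lw].
  case/andP=> /orP[] hS kd ->; last by have := dist _ hS; move: lw;
    rewrite /label /=; lia.
  have cc : cellof (v, w) \in cells k m by rewrite -nontrivialE //; exact: dS.
  by rewrite cellsetE.
case: p pS e => [a b] abS e.
have ea : a = v by apply: val_inj; move: c1; rewrite -e /cellof /= => -[].
exists b; last by rewrite -ea -e.
rewrite mem_enum inE /neighbor -ea abS /=.
rewrite (nontrivialE (dS _ abS)) e cc andbT.
by rewrite /label ltnS (dist _ abS).
Qed.

End Triangulations.

(** * Lattice paths as words *)

(* The label of the east step of path [j] at height [a] over a column where    *)
(* path [j + 1] has height [b]: the label [i] occurs [h_(i-1)] times if        *)
(* [i <= k + 1], and [m - s - u_s] times if [i = k + 1 + s].                   *)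
Definition step_label k m j a b := if m <= a then j else if a == b then j.+1
  else k.+1 + (m - a).
Definition step_labels k m j (U P : seq nat) := [seq step_label k m j ab.1 ab.2
  | ab <- zip U P].
Definition pathle (P U : seq nat) := all2 leq P U.

Fixpoint fan_chain (B U : seq nat) (r : seq (seq nat)) : bool :=
  if r is P :: r' then pathle P U && fan_chain B P r' else pathle B U.
Fixpoint chain_labels k m j (B U : seq nat) (r : seq (seq nat)) : seq nat :=
  if r is P :: r' then step_labels k m j U P ++ chain_labels k m j.+1 B P r'
    else step_labels k m j U B.

Fixpoint seqsof (A : seq (seq nat)) k : seq (seq (seq nat)) :=
  if k is k'.+1 then [seq P :: r | P <- A, r <- seqsof A k'] else [:: [::]].

Definition isfan m (r : seq (seq nat)) := if r is P :: r' then fan_chain (bot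
  m) P r' else false.
Definition fan_labels k m (r : seq (seq nat)) :=
  if r is P :: r' then chain_labels k m 1 (bot m) P r' else [::].
Definition fans k m := [seq r <- seqsof (wpaths m m) k | isfan m r].

Lemma seqsof_uniq A k : uniq A -> uniq (seqsof A k).
Proof.
move=> uA; elim: k => //= k IH; apply: allpairs_uniq => //.
by move=> [P r] [P' r'] _ _ [-> ->].
Qed.

Lemma mem_seqsof A k r : (r \in seqsof A k) = (size r == k) && all (mem A) r.
Proof.
elim: k r => [|k IH] [|P r] //.
  by apply/negbTE/negP => /allpairsP[[P r] [_ _]].
apply/allpairsP/idP => [[[P' r'] /= [hP hr [-> ->]]]|/= /andP[sr /andP[PA rA]]].
  by rewrite /= hP eqSS -IH.
by exists (P, r); split=> //=; rewrite IH; apply/andP; split.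
Qed.

Section FanSum.
Variable R : idomainType.
Local Open Scope ring_scope.
Implicit Types (t : nat -> R).

Lemma bot_wpaths m : bot m \in wpaths m m.
Proof.
apply/wpathsP; rewrite size_rev size_iota; split=> //; rewrite path_sortedE;
  last first.
  by move=> a b c; rewrite /geq /=; lia.
rewrite rev_sorted; apply/andP; split;
  last by rewrite (sub_sorted _ (iota_sorted 0 m)).
by apply/allP => x; rewrite mem_rev mem_iota /=; lia.
Qed.

Lemma pair_weight_labels k m t j U P : (0 < j)%N -> size U = size P ->
  pair_weight (path_factor k m t j) U P =
    (pathle P U)%:R * \prod_(l <- step_labels k m j U P) t l.
Proof.
move=> j0; elim: U P => [|u U IH] [|p P] //=; first by rewrite big_nil mulr1.
move=> [sUP]; rewrite IH // big_cons /path_factor eqn0Ngt j0 /=.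
case: (p <= u)%N => /=; last by rewrite !mul0r.
rewrite mulrCA; congr (_ * (_ * _)); rewrite /step_label.
by case: ifP => // _; case: ifP.
Qed.

Lemma foldr_sum k m t j n U : (0 < j)%N -> U \in wpaths m m ->
  foldr (transfer (wpaths m m)) (is_bot R m) [seq path_factor k m t i | i <-
    iota j n.+1] U =
  \sum_(r <- seqsof (wpaths m m) n) (fan_chain (bot m) U r)%:R *
     \prod_(l <- chain_labels k m j (bot m) U r) t l.
Proof.
have sz P : P \in wpaths m m -> size P = m by case/wpathsP.
elim: n j U => [|n IH] j U j0 hU.
  rewrite [RHS]big_seq1 /= /transfer (bigD1_seq (bot m)) ?wpaths_uniq
    ?bot_wpaths //=.
  rewrite big1 ?addr0 => [|P /negbTE Pb]; last by rewrite /is_bot Pb mulr0.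
  by rewrite /is_bot eqxx mulr1 pair_weight_labels // !sz // bot_wpaths.
rewrite -[foldr _ _ _ _]/(transfer (wpaths m m) (path_factor k m t j) (foldr
  (transfer (wpaths m m))
  (is_bot R m) [seq path_factor k m t i | i <- iota j.+1 n.+1]) U).
rewrite {1}/transfer -[seqsof _ n.+1]/[seq P :: r | P <- wpaths m m,
  r <- seqsof (wpaths m m) n].
rewrite big_allpairs_dep big_seq [RHS]big_seq; apply: eq_bigr => P hP.
rewrite IH // big_distrr /=; apply: eq_bigr => r _.
by rewrite pair_weight_labels // ?sz // big_cat /= -mulnb natrM mulrACA.
Qed.

Lemma fan_gf_fans k m t : (0 < k)%N ->
  fan_gf k m t = \sum_(r <- fans k m) \prod_(l <- fan_labels k m r) t l.
Proof.
case: k => // k _; rewrite /fan_gf -[iota 0 _]/(0%N :: iota 1 k.+1) map_cons.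
set K := k.+1.
rewrite -[LHS]/(transfer (wpaths m m) (path_factor K m t 0) (foldr (transfer
  (wpaths m m)) (is_bot R m)
  [seq path_factor K m t i | i <- iota 1 k.+1]) (top m)).
rewrite {1}/transfer big_filter [RHS]big_mkcond.
rewrite -[seqsof _ K]/[seq P :: r | P <- wpaths m m,
  r <- seqsof (wpaths m m) k].
rewrite big_allpairs_dep big_seq [RHS]big_seq.
apply: eq_bigr => P hP; rewrite foldr_sum // big_distrr /=;
  apply: eq_bigr => r _.
have [sP _] := wpathsP _ _ _ hP.
have -> : pair_weight (path_factor K m t 0) (top m) P = 1.
  by rewrite /top -[X in nseq X]sP pair_weight1 // => j p /(wpaths_le hP).
by rewrite mul1r; case: fan_chain; rewrite ?mul1r ?mul0r.
Qed.

End FanSum.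

(** * Words of steps and their height lists *)

Lemma size_east y w : size (east_heights y w) = count_mem stepE w.
Proof. by elim: w y => //= -[] w IH y /=; rewrite ?add0n ?add1n IH. Qed.

Lemma path_east y w :
  path leq y (east_heights y w) && all (geq (y +
    count_mem stepN w)) (east_heights y w).
Proof.
elim: w y => //= -[] w IH y /=; have := IH y.+1; have {IH} := IH y.
  move=> _ /andP[pw aw]; apply/andP; split.
    by case: (east_heights _ _) pw => //= h s /andP[hy ->]; rewrite (ltnW hy).
  by apply: sub_all aw => h; rewrite /geq /=; lia.
rewrite add0n => /andP[pw aw] _; rewrite leqnn pw /= aw andbT /geq /=; lia.
Qed.

Lemma east_inj y w w' : count_mem stepN w = count_mem stepN w' ->
  east_heights y w = east_heights y w' -> w = w'.
Proof.
have nilE v : count_mem stepN v = 0 -> count_mem stepE v = 0 -> v = [::].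
  by case: v => // -[].
have low v z s : east_heights z.+1 v <> z :: s.
  by move=> e; have := path_east z.+1 v; rewrite e /= ltnn.
elim: w w' y => [|s w IH] w' y.
  move=> c e; apply/esym/nilE; first by rewrite -c.
  by rewrite -(size_east y) -e.
case: w' => [|s' w'].
  move=> c e; apply: nilE; first by rewrite c.
  by rewrite -(size_east y) e.
case: s; case: s' => /=; rewrite ?add0n ?add1n.
- by move=> [c] e; rewrite (IH w' y.+1).
- by move=> _ /low.
- by move=> _ /esym/low.
by move=> c [e]; rewrite (IH w' y).
Qed.

Fixpoint wordof m y (hs : seq nat) : seq step :=
  if hs is h :: hs' then nseq (h - y) stepN ++ stepE :: wordof m h hs'
  else nseq (m - y) stepN.

Lemma east_nseq y d w : east_heights y (nseq d stepN ++ w) =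
  east_heights (y + d) w.
Proof. by elim: d y => [|d IH] y /=; rewrite ?addn0 // IH addSnnS. Qed.

Lemma wordofP m y hs : y <= m -> path leq y hs -> all (geq m) hs ->
  [/\ east_heights y (wordof m y hs) = hs,
      count_mem stepN (wordof m y hs) = m - y &
      count_mem stepE (wordof m y hs) = size hs].
Proof.
elim: hs y => [|h hs IH] y ym /=.
  move=> _ _; rewrite !count_nseq /= mul1n mul0n; split=> //.
  by rewrite -[nseq _ _]cats0 east_nseq.
case/andP=> yh ph /andP[hm ah]; have [e1 e2 e3] := IH h hm ph ah.
rewrite east_nseq subnKC //= e1 !count_cat !count_nseq /= e2 e3 mul1n mul0n.
by split=> //; rewrite /geq /= in hm; lia.
Qed.

Definition heights (w : seq step) : seq nat := rev (east_heights 0 w).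

Lemma heights_wpaths m w : is_path m w -> heights w \in wpaths m m.
Proof.
case/andP=> /eqP cN /eqP cE; apply/wpathsP; rewrite size_rev size_east;
  split=> //.
have /andP[pw aw] := path_east 0 w; rewrite add0n cN in aw.
rewrite path_sortedE; last by move=> a b c; rewrite /geq /=; lia.
by rewrite all_rev aw /heights rev_sorted; move: pw;
  case: east_heights => //= a l /andP[].
Qed.

Lemma heights_inj m : {in is_path m &, injective heights}.
Proof.
move=> w w' /andP[/eqP cN _] /andP[/eqP cN' _] /(can_inj revK); apply: east_inj.
by rewrite cN cN'.
Qed.

Lemma heights_surj m p : p \in wpaths m m ->
  exists2 w, is_path m w & heights w = p.
Proof.
case/wpathsP=> sp; rewrite path_sortedE; last by move=> a b c;
  rewrite /geq /=; lia.
case/andP=> ap; rewrite -[p in sorted _ p]revK rev_sorted => pp.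
have p0 : path leq 0 (rev p) by case: (rev p) pp.
have [|e1 e2 e3] := wordofP (leq0n m) p0; first by rewrite all_rev.
exists (wordof m 0 (rev p)); last by rewrite /heights e1 revK.
by rewrite /is_path e2 e3 subn0 size_rev sp !eqxx.
Qed.

Lemma east_topT m : east_heights 0 (topT m) = nseq m m.
Proof.
have E d y : east_heights y (nseq d stepE) = nseq d y by elim: d => //= d ->.
by rewrite /topT east_nseq E.
Qed.

Lemma east_botB m : east_heights 0 (botB m) = iota 0 m.
Proof. by rewrite /botB; elim: m 0 => //= m IH y; rewrite IH. Qed.

Lemma pathle_rev m (s s' : seq nat) : size s = m -> size s' = m ->
  pathle (rev s) (rev s') = [forall x : 'I_m, nth 0 s x <= nth 0 s' x].
Proof.
move=> ss ss'; rewrite /pathle all2E !size_rev ss ss' eqxx /= -rev_zip ?ss //.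
rewrite all_rev; apply/(all_nthP (0, 0))/forallP => h i.
  have := h i; rewrite size_zip ss ss' minnn => /(_ (ltn_ord i)).
  by rewrite nth_zip ?ss.
rewrite size_zip ss ss' minnn => im; rewrite nth_zip ?ss //=.
exact: (h (Ordinal im)).
Qed.

Lemma pathle_trans : transitive pathle.
Proof.
move=> q p r; elim: q p r => [|b q IH] [|a p] [|c r] //= /andP[ab pq] /andP[bc
  qr].
by rewrite (leq_trans ab bc) (IH _ _ pq).
Qed.

Lemma fan_chainE B U r :
  fan_chain B U r = path (fun U P => pathle P U) U r && all (pathle B) (U :: r).
Proof.
elim: r U => [|P r IH] U /=; first by rewrite andbT.
rewrite IH /=; case PU: (pathle P U) => //=; case: path => //=.
by case BP: (pathle B P) => //=; rewrite ?andbF // (pathle_trans BP PU).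
Qed.

Lemma size_heights m w : is_path m w -> size (east_heights 0 w) = m.
Proof. by case/andP=> _ /eqP <-; exact: size_east. Qed.

Lemma weakly_aboveE m w w' : is_path m w -> is_path m w' ->
  weakly_above m w w' = pathle (heights w') (heights w).
Proof. by move=> hw hw'; rewrite (@pathle_rev m) ?(size_heights hw)
  ?(size_heights hw'). Qed.

Lemma botB_path m : is_path m (botB m).
Proof.
by rewrite /is_path /botB; elim: m.
Qed.

Lemma topT_path m : is_path m (topT m).
Proof.
by rewrite /is_path /topT !count_cat !count_nseq /= !mul1n !mul0n addn0 add0n
  !eqxx.
Qed.

Lemma in_D_fans m k (P : k.-tuple (seq step)) : 0 < k ->
  in_D m P = all (is_path m) P && ([seq heights w | w <- P] \in fans k m).
Proof.
move=> k0; rewrite /in_D mem_filter mem_seqsof size_map size_tuple eqxx /=.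
have [isP|] := boolP (all (is_path m) P); last first.
  by move=> np; apply/negbTE/negP => /andP[aP _]; move/negP: np; apply;
     apply: sub_all aP => w /and3P[].
have -> : all (mem (wpaths m m)) [seq heights w | w <- P].
  by rewrite all_map; apply: sub_all isP => w /heights_wpaths.
have allE : all (fun w => [&& is_path m w, weakly_above m w (botB m)
      & weakly_above m (topT m) w]) P = all (pathle (bot m)) [seq heights w | w
        <- P].
  rewrite all_map; apply: eq_in_all => w wP /=; have hw := allP isP _ wP.
  rewrite hw /= !weakly_aboveE ?botB_path ?topT_path // /heights east_botB
    east_topT.
  rewrite -/(bot m) -/(heights w) andbC (@pathle_rev m) ?size_nseq
    ?(size_heights hw) //.
  have -> // : [forall x : 'I_m, nth 0 (east_heights 0 w) x <= nth 0 (nseq m m)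
    x].
  apply/forallP => x; rewrite nth_nseq ltn_ord.
  have /andP[_ /allP] := path_east 0 w; case/andP: (hw) => /eqP -> _; apply.
  by rewrite mem_nth // (size_heights hw).
rewrite allE andbT /=; case: (tval P) isP (size_tuple P) k0 => [_ <-|w ws] //=.
case/andP=> hw hws _ _; rewrite fan_chainE andbC /=; congr (_ && _).
elim: ws w hw hws => //= w' ws IH w hw /andP[hw' hws].
by rewrite weakly_aboveE // IH.
Qed.

Lemma count_step_labels k m j (u p : seq nat) i : size u = m -> size p = m ->
  count_mem i (step_labels k m j (rev u) (rev p)) =
  \sum_(x < m) (step_label k m j (nth 0 u x) (nth 0 p x) == i).
Proof.
move=> su sp; rewrite /step_labels -rev_zip ?su // count_map count_rev.
rewrite -sum1_count big_mkcond (big_nth (0, 0)) size_zip su sp minnn big_mkord.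
by apply: eq_bigr => x _; rewrite nth_zip ?su //=; case: eqP.
Qed.

Lemma chain_labelsE k m j B U r : chain_labels k m j B U r =
  flatten [seq step_labels k m (j + l) (nth [::] (U :: rcons r B) l)
                                (nth [::] (rcons r B) l) | l <- iota 0 (size
                                  r).+1].
Proof.
elim: r j U => [|P r IH] j U; first by rewrite /= addn0 cats0.
have -> : iota 0 (size (P :: r)).+1 = 0 :: [seq 1 +
  l | l <- iota 0 (size r).+1].
  by rewrite -(iotaDl 1 0).
have fc (x : seq nat) xs : flatten (x :: xs) = x ++ flatten xs by [].
rewrite map_cons -map_comp fc [LHS]/= IH addn0.
by congr (_ ++ flatten _); apply: eq_map => l; rewrite /= add1n addSnnS.
Qed.

Lemma count_fan_labels m k (P : k.-tuple (seq step)) i : 0 < k ->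
  all (is_path m) P ->
  count_mem i (fan_labels k m [seq heights w | w <- P]) =
  \sum_(x < m) \sum_(l <- iota 1 k)
     (step_label k m l (east_height (path_at m P l) x) (east_height (path_at m
       P l.+1) x) == i).
Proof.
move=> k0 isP; have isB : all (is_path m) (rcons P (botB m)).
  by rewrite all_rcons botB_path.
have -> : fan_labels k m [seq heights w | w <- P] = flatten
   [seq step_labels k m l (heights (path_at m P l)) (heights (path_at m P
     l.+1)) | l <- iota 1 k].
  rewrite /path_at; case: (tval P) (size_tuple P) k0 => [<-//|w ws] /= <- _.
  rewrite chain_labelsE size_map -[iota 1 _]/(iota (1 +
    0) _) iotaDl -map_comp; congr flatten.
  apply/eq_in_map => l; rewrite mem_iota => hl /=.
  have bE : bot m = heights (botB m) by rewrite /heights east_botB.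
  have hl1 : l < size (rcons ws (botB m)) by rewrite size_rcons; lia.
  by rewrite add1n bE -map_rcons -(map_cons heights) !(nth_map [::]) //= ltnW.
rewrite exchange_big count_flatten sumnE !big_map big_seq [RHS]big_seq.
apply: eq_bigr => l; rewrite mem_iota => hl.
have szP l' : 0 < l' <= k.+1 -> size (east_heights 0 (path_at m P l')) = m.
  move=> hl'; apply: size_heights; apply: (allP isB); rewrite /path_at.
  by case: l' hl' => // l' hl'; rewrite /= mem_nth // size_rcons size_tuple;
    lia.
by rewrite count_step_labels // szP //; lia.
Qed.

(** * Multiplicities of labels within one column *)

Lemma sum_only (s : seq nat) (F : nat -> nat) l0 : l0 \in s -> uniq s ->
  (forall l, l \in s -> l != l0 -> F l = 0) -> \sum_(l <- s) F l = F l0.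
Proof.
move=> h u F0; rewrite (bigD1_seq l0) //= big_seq_cond big1 ?addn0 // => l.
by case/andP; exact: F0.
Qed.

(** Label i can come from path i at the top height, or from path i-1 touching path i below the top;
    the height of path i decides which of the two is possible. *)
Lemma sum_label_h (H : nat -> nat) k m i :
  H 0 = m -> (forall l, l <= k -> H l.+1 <= H l) -> H k.+1 < m ->
    0 < i <= k.+1 ->
  \sum_(l <- iota 1 k) (step_label k m l (H l) (H l.+1) == i) = (H i.-1 == H i).
Proof.
move=> H0 Hle Hk hi; have mono a b : a <= b <= k.+1 -> H b <= H a.
  elim: b => [|b IH] hb; first by have -> : a = 0 by lia.
  have [->//|ab] := eqVneq a b.+1.
  by apply: leq_trans (Hle b _) (IH _); lia.
have Hm l : l <= k.+1 -> H l <= m by rewrite -H0 => lk; apply: mono; lia.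
have Hi := Hm i ltac:(lia); have Hi1 := Hm i.-1 ltac:(lia).
have Hi' := mono i.-1 i ltac:(lia).
case: (ltnP (H i) m) => him; last first.
  have ik : i <= k.
    rewrite leqNgt; apply/negP => ik; have e : i = k.+1 by lia.
    by move: him; rewrite e leqNgt Hk.
  rewrite (@sum_only _ _ i) ?iota_uniq ?mem_iota //; last first.
  - move=> l; rewrite mem_iota => hl li; rewrite /step_label;
    case: (leqP m (H l)) => hlm.
      by rewrite (negbTE li).
    have il : i < l.
      by rewrite ltnNge; apply/negP => lei; have := mono l i ltac:(lia); lia.
    by case: (H l == H l.+1); lia.
  - by lia.
  by rewrite /step_label him eqxx; have -> : H i.-1 == H i by lia.
have zero l : 0 < l <= k -> l != i.-1 ->
  (step_label k m l (H l) (H l.+1) == i) = 0 :> nat.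
  move=> hl li; rewrite /step_label; case: (leqP m (H l)) => hlm.
    by case: eqP => // e; move: him hlm; rewrite -e; lia.
  by case: (H l == H l.+1); lia.
case: (posnP i.-1) => i1.
  rewrite big1_seq; last by move=> l; rewrite mem_iota => hl; apply: zero; lia.
  by rewrite i1 H0; case: eqP => // e; lia.
rewrite (@sum_only _ _ i.-1) ?iota_uniq ?mem_iota //; last first.
- by move=> l; rewrite mem_iota => hl; apply: zero; lia.
- by lia.
rewrite prednK; last by lia.
by rewrite /step_label; case: (leqP m (H i.-1)) => hlm;
  case: (eqVneq (H i.-1) (H i)) => e; lia.
Qed.

(** Paths sharing a step are consecutive, and only the last of them is not in contact with its
    successor; a used step above the final path is thus counted once. *)
Lemma sum_last_at_height (H : nat -> nat) y p n :
  (forall l, p <= l < p + n -> H l.+1 <= H l) ->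
  \sum_(l <- iota p n) ((H l == y) && (H l != H l.+1)) =
  (H (p + n) < y) && has (fun l => H l == y) (iota p n).
Proof.
elim: n p => [|n IH] p hH; first by rewrite big_nil andbF.
have mono a b : p <= a -> a <= b -> b <= p + n.+1 -> H b <= H a.
  move=> pa; elim: b => [|b IHb] ab bn; first by have -> : a = 0 by lia.
  have [->//|ne] := eqVneq a b.+1.
  by apply: leq_trans (hH b _) (IHb _ _); lia.
rewrite [iota p n.+1]/= big_cons IH; last by move=> l hl; apply: hH; lia.
rewrite [has _ _]/= addSnnS; have [e|ne] := eqVneq (H p) y => /=; last first.
  by rewrite (negbTE ne).
rewrite -e; have h1 := mono p p.+1 ltac:(lia) ltac:(lia) ltac:(lia).
have h2 := mono p.+1 (p + n.+1) ltac:(lia) ltac:(lia) ltac:(lia).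
have [e1|ne1] := eqVneq (H p) (H p.+1).
  rewrite add0n; case: n IH hH mono h2 => [|n] _ _ _ h2.
    by rewrite andbF; move: h2; rewrite addn1 -e1 ltnn.
  by rewrite /= -e1 eqxx andbT.
have -> : (H (p + n.+1) < H p) = true by lia.
have -> : has (fun l => H l == H p) (iota p.+1 n) = false.
  apply/hasP => -[l]; rewrite mem_iota => hl /eqP el.
  by have := mono p.+1 l ltac:(lia) ltac:(lia) ltac:(lia); lia.
by rewrite andbF eqxx.
Qed.

Lemma sum_label_u (H : nat -> nat) k m s :
  (forall l, 0 < l <= k -> H l.+1 <= H l) -> 0 < s < m ->
  \sum_(l <- iota 1 k) (step_label k m l (H l) (H l.+1) == k.+1 + s) =
  (H k.+1 < m - s) && has (fun l => H l == m - s) (iota 1 k).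
Proof.
move=> Hle hs; rewrite -[k.+1 in RHS]add1n -sum_last_at_height;
  last by move=> l hl; apply: Hle; lia.
rewrite big_seq [RHS]big_seq; apply: eq_bigr => l; rewrite mem_iota => hl.
congr nat_of_bool; rewrite /step_label; case: (leqP m (H l)) => hlm;
  case: (eqVneq (H l) (H l.+1)) => e;
  rewrite ?andbF ?andbT; lia.
Qed.

(** * Statistics and the bijection *)

Section FanStatistics.
Variables (k m : nat) (P : k.-tuple (seq step)).
Hypotheses (k0 : 0 < k) (DP : in_D m P).
Let H l x := east_height (path_at m P l) x.

Lemma fan_path : path (weakly_above m) (topT m) (rcons P (botB m)).
Proof.
case/andP: DP => aP sP; rewrite rcons_path.
case: (tval P) aP sP (size_tuple P) k0 => [_ _ <-|w ws] //= /andP[/and3P[_ hB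
  ->] aP] -> _ _.
by case/lastP: ws aP => [|ws w'] //; rewrite last_rcons all_rcons =>
  /andP[/and3P[]].
Qed.

Lemma fan_le l x : l <= k -> x < m -> H l.+1 x <= H l x.
Proof.
move=> lk xm; have /(pathP [::])/(_ l) := fan_path.
rewrite size_rcons size_tuple ltnS => /(_ lk) /forallP /(_ (Ordinal xm)).
by rewrite /H /path_at.
Qed.

Lemma fan_top x : x < m -> H 0 x = m.
Proof. by move=> xm; rewrite /H /path_at /= /east_height east_topT nth_nseq xm.
  Qed.

Lemma fan_bot x : x < m -> H k.+1 x = x.
Proof.
move=> xm; rewrite /H /path_at /= nth_rcons size_tuple ltnn eqxx.
by rewrite /east_height east_botB nth_iota.
Qed.

Lemma fan_is_path : all (is_path m) P.
Proof. by have := in_D_fans m P k0; rewrite DP => /esym/andP[]. Qed.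

Lemma count_param_h i : 0 < i <= k.+1 ->
  count_mem i (fan_labels k m [seq heights w | w <- P]) = param_h m P i.-1.
Proof.
move=> hi; rewrite count_fan_labels ?fan_is_path // /param_h -sum1dep_card
  [RHS]big_mkcond /=.
apply: eq_bigr => x _; have xm := ltn_ord x.
rewrite -/(H _ _) (@sum_label_h (fun l => H l x)) //.
- by rewrite prednK; [case: eqP | lia].
- exact: fan_top.
- by move=> l lk; apply: fan_le.
- by rewrite fan_bot.
Qed.

Lemma count_param_u s : 0 < s < m ->
  count_mem (k.+1 + s) (fan_labels k m [seq heights w | w <- P]) +
    param_u m P s = m - s.
Proof.
move=> hs; rewrite count_fan_labels ?fan_is_path // /param_u -sum1dep_card [X
  in _ + X]big_mkcond /=.
rewrite -big_split /= (eq_bigr (fun x : 'I_m => (x < m - s : nat))).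
  rewrite -big_mkcond /= sum1dep_card.
  rewrite -[RHS](card_ord (m - s)); have le : m - s <= m by lia.
  have wi : injective (widen_ord le) by move=> y z /(congr1 val) /= /val_inj.
  rewrite -(card_imset _ wi); apply: eq_card => x; rewrite inE.
  apply/idP/imsetP => [h|[y _ ->]]; last exact: (ltn_ord y).
  by exists (Ordinal h) => //; apply: val_inj.
move=> x _; have xm := ltn_ord x.
rewrite (@sum_label_u (fun l => H l x)) //; last by move=> l lk;
  apply: fan_le; lia.
rewrite fan_bot // /east_height east_botB east_topT nth_iota // nth_nseq xm
  add0n.
have -> : m - s < m by lia.
rewrite andbT; case: ltnP => //= _.
have -> : has (fun l => H l x == m - s) (iota 1 k) =
          ~~ all (fun w => nth 0 (east_heights 0 w) x != m - s) P;
            last by case: all.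
rewrite -has_predC; apply/hasP/hasP => [[l]|[w wP /= e]].
  rewrite mem_iota => hl e; exists (path_at m P l); last by rewrite /= negbK.
  case: l hl e => // l hl _; rewrite /path_at /= nth_rcons size_tuple.
  by rewrite (_ : l < k) ?mem_nth ?size_tuple //; lia.
exists (index w P).+1; first by rewrite mem_iota; have := wP;
  rewrite -index_mem size_tuple; lia.
rewrite negbK in e; rewrite /H /path_at /= nth_rcons index_mem wP nth_index //.
Qed.

End FanStatistics.

(** * From equal generating functions to a bijection *)

Lemma digits B (s1 s2 : seq nat) : size s1 < B -> size s2 < B ->
  \sum_(i <- s1) B ^ i = \sum_(i <- s2) B ^ i ->
  forall i, count_mem i s1 = count_mem i s2.
Proof.
(* The multiplicity of 0 is the lowest base B digit; [sh] removes the zeros and shifts the other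
   digits down. *)
pose sh (s : seq nat) := [seq x.-1 | x <- s & 0 < x].
have shE (s : seq nat) : \sum_(i <- s) B ^ i =
  count_mem 0 s + B * \sum_(i <- sh s) B ^ i.
  elim: s => [|[|x] s IH]; first by rewrite !big_nil muln0.
    by rewrite big_cons IH expn0 /= addnA.
  by rewrite /sh /= !big_cons IH mulnDr -expnS /= add0n addnCA.
have shc i (s : seq nat) : count_mem i.+1 s = count_mem i (sh s).
  by rewrite /sh count_map; elim: s => //= -[|x] s IH /=; rewrite IH.
have shs (s : seq nat) : size (sh s) <= size s.
  by rewrite size_map size_filter count_size.
have B0 : 0 < B -> forall a b c d, a < B -> b < B -> a + B * c = b + B * d ->
    a = b /\ c = d.
  move=> B0 a b c d aB bB e; have := congr1 (modn^~ B) e;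
    have := congr1 (divn^~ B) e.
  by rewrite /= ![_ + B * _]addnC ![B * _]mulnC !divnMDl // !modnMDl
    !divn_small //
    !modn_small // !addn0.
have c0 (s : seq nat) : size s < B -> count_mem 0 s < B.
  by apply: leq_ltn_trans; apply: count_size.
move=> h1 h2 + i; elim: i s1 s2 h1 h2 => [|i IH] s1 s2 h1 h2;
  rewrite (shE s1) (shE s2);
  case/(B0 (leq_ltn_trans (leq0n _) h1) _ _ _ _ (c0 _ h1) (c0 _ h2)) => // e1
    e2.
by rewrite !shc; apply: IH => //; apply: leq_ltn_trans (shs _) _.
Qed.

Lemma perm_of_poly (A C : eqType) (s1 : seq A) (s2 : seq C) (e1 : A ->
  nat) (e2 : C -> nat) :
  (\sum_(a <- s1) 'X^(e1 a) = \sum_(c <- s2) 'X^(e2 c) :> {poly int})%R ->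
  perm_eq [seq e1 a | a <- s1] [seq e2 c | c <- s2].
Proof.
have coefE (T : eqType) (s : seq T) (e : T -> nat) d :
    ((\sum_(a <- s) 'X^(e a) : {poly int})`_d =
      (count_mem d [seq e a | a <- s])%:R)%R.
  elim: s => [|a s IH]; first by rewrite big_nil coef0.
  by rewrite big_cons coefD IH coefXn /= natrD eq_sym.
move=> h; apply/allP => d _ /=; apply/eqP.
by apply/eqP; rewrite -(eqr_nat int) -!coefE h.
Qed.

(** Equal multisets of statistics allow the second list to be rearranged so that entries match
    position by position. *)
Lemma bij_of_perm (A : finType) (C : eqType) (c0 : C) (s : seq C) (f : A ->
  nat) (g : C -> nat) :
  uniq s -> perm_eq [seq f a | a <- enum A] [seq g c | c <- s] ->
  exists h : A -> C, [/\ injective h, forall a, h a \in s /\ g (h a) = f a &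
    forall c, c \in s -> exists a, h a = c].
Proof.
move=> us /(perm_iotaP (g c0))[Is pI e]; rewrite size_map in pI.
pose s' := [seq nth c0 s i | i <- Is].
have ps : perm_eq s' s by rewrite -[X in perm_eq _ X](mkseq_nth c0);
  apply: perm_map.
have us' : uniq s' by rewrite (perm_uniq ps).
have sA : size s' = #|A| by rewrite size_map cardE -(size_map f) e size_map.
have gs : [seq f a | a <- enum A] = [seq g c | c <- s'].
  rewrite e -map_comp; apply/eq_in_map => i;
    rewrite (perm_mem pI) mem_iota => hi.
  by rewrite (nth_map c0).
have ia a : index a (enum A) < size s' by rewrite sA cardE index_mem mem_enum.
exists (fun a => nth c0 s' (index a (enum A))); split.
- move=> a b /eqP; rewrite nth_uniq // => /eqP /(congr1 (nth a (enum A))).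
  by rewrite !nth_index ?mem_enum.
- move=> a; split; first by rewrite -(perm_mem ps) mem_nth.
  have := congr1 (fun l => nth 0 l (index a (enum A))) gs.
  rewrite (nth_map a) -?cardE ?sA; last by rewrite -sA ia.
  by rewrite nth_index ?mem_enum // (nth_map c0).
move=> c; rewrite -(perm_mem ps) => cs'.
have ic : index c s' < #|A| by rewrite -sA index_mem.
pose a := enum_val (Ordinal ic); exists a.
have ea : a = nth a (enum A) (index c s') by exact: enum_val_nth.
by rewrite ea index_uniq ?enum_uniq -?cardE // nth_index.
Qed.

Lemma fans_heights k m (r : seq (seq nat)) : 0 < k -> r \in fans k m ->
  exists P : {P : k.-tuple (seq step) | in_D m P},
    [seq heights w | w <- val P] == r.
Proof.
move=> k0 rf; have := rf; rewrite mem_filter mem_seqsof => /and3P[_ /eqP sr ar].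
have [ws aw ew] : exists2 ws, all (is_path m) ws & [seq heights w | w <- ws] =
  r.
  elim: r ar {rf sr} => [|p r IH] /=; first by exists [::].
  case/andP=> /heights_surj[w pw ew] /IH[ws aw ews].
  by exists (w :: ws); rewrite /= ?pw // ew ews.
have sw : size ws == k by rewrite -sr -ew size_map.
have D : in_D m (Tuple sw) by rewrite in_D_fans // aw ew.
by exists (exist _ (Tuple sw) D); rewrite /= ew.
Qed.

Lemma in_D_inj k m : 0 < k ->
  injective (fun P : {P : k.-tuple (seq step) | in_D m P} => [seq heights w | w
    <- val P]).
Proof.
move=> k0 [P DP] [Q DQ] /= e; apply/val_inj/val_inj => /=.
have /allP aP := fan_is_path k0 DP; have /allP aQ := fan_is_path k0 DQ.
elim: (tval P) (tval Q) aP aQ e => [|w ws IH] [|w' ws'] //= aP aQ [ew ews].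
rewrite (heights_inj (aP _ (mem_head _ _)) (aQ _ (mem_head _ _)) ew) (IH ws')
  // => x xs.
  by apply: aP; rewrite inE xs orbT.
by apply: aQ; rewrite inE xs orbT.
Qed.

Lemma prod_Xn (T : Type) (s : seq T) (e : T -> nat) :
  (\prod_(i <- s) 'X^(e i) = 'X^(\sum_(i <- s) e i) :> {poly int})%R.
Proof. by elim: s => [|x s IH]; rewrite ?big_nil // !big_cons IH exprD. Qed.

Theorem theorem7p4 (k n : nat) (hk : (1 <= k)%N) (hn : (2 * k + 1 <= n)%N) :
  exists f : {S : {set 'I_n * 'I_n} | ktriangulation k S} ->
             {P : k.-tuple (seq step) | in_D (n - 2 * k - 1) P},
    bijective f /\
    forall (S : {S : {set 'I_n * 'I_n} | ktriangulation k S}) (v : 'I_n),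
      let m := (n - 2 * k - 1)%N in
      let P := val (f S) in
      let i := label v in
      (i <= n - k - 1)%N ->
      ((degree k (val S) v)%:Z =
        if (i <= k + 1)%N then (param_h m P (i - 1))%:Z
        else n%:Z - i%:Z - k%:Z - (param_u m P (i - k - 1))%:Z)%R.
Proof.
set m := (n - 2 * k - 1)%N; have nE : n = (2 * k + m).+1 by rewrite /m; lia.
(* [B] exceeds the number of labels on either side, so base B sums have no carries, and it is at
   least 2, which makes [t] injective. *)
pose B := (size (cells k m) + \max_(r <- fans k m) size (fan_labels k m r)).+2.
pose tri := {S : {set 'I_n * 'I_n} | ktriangulation k S}.
pose eX (T : tri) := \sum_(c <- network_of k m (val T)) B ^ c.1.
pose eF r := \sum_(l <- fan_labels k m r) B ^ l.
(* A product of such monomials is X to the sum of the B^i, which encodes the whole multiset of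
   labels in one exponent. *)
pose t i : {poly int} := ('X^(B ^ i))%R.
have t_inj : injective t.
  move=> i j /(congr1 (fun p : {poly int} => size p)); rewrite !size_polyXn => -[].
  exact: expnI.
have t_neq0 i : t i != 0%R by rewrite expf_neq0 // polyX_eq0.
have perm : perm_eq [seq eX a | a <- enum {: tri}] [seq eF r | r <- fans k m].
  apply: perm_of_poly; have := network_gf_fan_gf k m t_inj t_neq0.
  rewrite network_gf_cells_op cells_op_subs ?rows_uniq // fan_gf_fans // -big_filter.
  rewrite -(perm_big _ (perm_network_of hk nE)) /= big_map => e.
  transitivity (\sum_(a : tri) \prod_(c <- network_of k m (val a)) t c.1)%R.
    by rewrite big_enum; apply: eq_bigr => a _; rewrite prod_Xn.
  rewrite -big_enum e; apply: eq_bigr => r _; exact: prod_Xn.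
have uF : uniq (fans k m) by rewrite filter_uniq // seqsof_uniq // wpaths_uniq.
have [h [h_inj hF h_surj]] := bij_of_perm [::] uF perm.
have exP a := fans_heights hk (hF a).1.
pose f a := xchoose (exP a).
have fE a : [seq heights w | w <- val (f a)] = h a.
  by apply/eqP; exact: (xchooseP (exP a)).
have exS P : exists a, f a == P.
  have [a ea] : exists a, h a = [seq heights w | w <- val P].
    by apply: h_surj; have := valP P; rewrite in_D_fans // => /andP[].
  by exists a; apply/eqP/(in_D_inj hk); rewrite /= fE.
exists f; split.
  exists (fun P => xchoose (exS P)) => [a|P]; last exact/eqP/(xchooseP (exS P)).
  apply: h_inj; rewrite -!fE; congr [seq heights w | w <- val _].
  exact/eqP/(xchooseP (exS (f a))).
move=> S v; rewrite /= -/m; set P := val (f S); rewrite /label => hv.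
have DP : in_D m P := valP (f S).
have cnt i : count (fun c => c.1 == i) (network_of k m (val S)) =
    count_mem i (fan_labels k m (h S)).
  rewrite -(count_map fst (pred1 i)); apply: (@digits B); last first.
  - rewrite big_map; have [_ e] := hF S; exact: esym e.
  - rewrite ltnS leqW // (leq_trans _ (leq_addl _ _)) //.
    by apply: (leq_bigmax_seq (h S)) => //; exact: (hF S).1.
  - by rewrite size_map size_filter ltnS leqW // (leq_trans (count_size _ _)) // leq_addr.
rewrite (degree_network_of hk nE v (valP S)) cnt -fE -/P.
case: ifP => hi; first by rewrite count_param_h ?subn1 //; lia.
(* Here i = k+1+s with 0 < s < m, and m - s = n - i - k. *)
have hs : 0 < v.+1 - k - 1 < m by lia.
have := count_param_u hk DP hs.
have -> : k.+1 + (v.+1 - k - 1) = v.+1 by lia.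
set c := count_mem _ _; set u := param_u _ _ _ => e.
by move: (nat_of_ord v) c u nE hi hv hs e; clear; clearbody m; lia.
Qed.
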